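(* Suppose that (A1)–(A8) hold. Let $L>0$ be arbitrary but fixed, $n\ge1$, $(\mathbf c_t,\mathbf u_t)=\big((c_t^1,\dots,c_t^n),(u_t^1,\dots,u_t^n)\big)\in\Omega_L^n$ and $$\mu_t:=\frac1n\sum_{j=1}^n\delta_{(c_t^j,u_t^j)}\in\mathcal P_2(\Omega_L).$$ Then $|\partial\mathcal J|(\mu_t)=|\partial J_n|(\mathbf c_t,\mathbf u_t)$.
   Context: Let $\mathcal C$ be a separable Banach space, $\mathcal M=\mathcal C^*$ its topological dual with the dual norm, and $Y$ a Hilbert space. Let $K:\mathcal M\to Y$, $\mathcal F:Y\to\mathbb R$, $\mathcal R:\mathcal M\to[0,+\infty]$ and $J(u):=\mathcal F(Ku)+\mathcal R(u)$ for $u\in\mathcal M$. Put $\mathrm{Dom}(\mathcal R):=\{u\in\mathcal M:\mathcal R(u)<+\infty\}$. Let $B:=\{u\in\mathcal M:\mathcal R(u)\le1\}$ and let $\tilde{\mathcal B}:=\overline{\mathrm{Ext}(B)}^{*}$ be the weak$^*$-closure of its set of extremal points. Fix a weak$^*$-closed subset $\mathcal B\subset\tilde{\mathcal B}$ and a metric $d_{\mathcal B}$ metrizing the weak$^*$-convergence on $\mathcal B$, such that $(\mathcal B,d_{\mathcal B})$ is geodesically complete, i.e. any two points are joined by a geodesic; a geodesic in a metric space $(X,d)$ is a curve $\gamma:[0,1]\to X$ with $d(\gamma_s,\gamma_t)=|s-t|d(\gamma_0,\gamma_1)$ for all $s,t$. Assumptions: (A1) $K$ is linear and weak$^*$-to-weak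 continuous. (A2) $\mathcal F$ is bounded from below, convex, and twice Fréchet differentiable on $Y$. (A3) $\mathcal R$ is convex, weak$^*$-lower semicontinuous and positively one-homogeneous: $\mathcal R(\lambda u)=\lambda\mathcal R(u)$ for all $\lambda\ge0$, $u\in\mathcal M$. (A4) For every $\alpha\ge0$ the sublevel set $\{u\in\mathcal M:\mathcal R(u)\le\alpha\}$ is weak$^*$-compact. (A5) $K$ is sequentially weak$^*$-to-strong continuous on $\mathrm{Dom}(\mathcal R)$. (A6) (no loss of mass) For every $n\in\mathbb N$, $\alpha^1,\dots,\alpha^n\ge0$ and $u^1,\dots,u^n\in\mathcal B$: $\mathcal R(\sum_j\alpha^ju^j)=\sum_j\alpha^j\mathcal R(u^j)$. (A7) $0\notin\mathcal B$. (A8) There is a constant $C=C(K,\mathcal B)>0$ such that for $m\in\{1,2\}$ and all geodesics $u_t:[0,1]\to\mathcal B$, $\sup_{t\in[0,1]}\big\|\frac{d^m}{dt^m}K(u_t)\big\|_Y\le C\,d_{\mathcal B}^m(u_0,u_1)$, where the derivatives are understood weakly, i.e. tested against elements of $Y$. Notation: $\Omega_L^n:=[0,L]^n\times\mathcal B^n$, with elements $(\mathbf c,\mathbf u)=((c^1,\dots,c^n),(u^1,\dots,u^n))$ and metric $d_n((\mathbf c,\mathbf u),(\tilde{\mathbf c},\tilde{\mathbf u})):=\big(\frac1n\sum_{j=1}^n(|c^j-\tilde c^j|^2+d_{\mathcal B}^2(u^j,\tilde u^j))\big)^{1/2}$; $\Omega_L:=\Omega_L^1$, $d_\Omega:=d_1$;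 $J_n(\mathbf c,\mathbf u):=J\big(\frac1n\sum_{j=1}^n(c^j)^2u^j\big)$ on $\Omega_L^n$. $\mathcal P_2(\Omega_L)$ is the set of Borel probability measures on $\Omega_L$ with the 2-Wasserstein distance $\mathcal W_2$ induced by $d_\Omega$, and $$\mathcal J(\nu):=\mathcal F\Big(\int_{\Omega_L}c^2Ku\,d\nu(c,u)\Big)+\int_{\Omega_L}c^2\,d\nu(c,u),\quad\nu\in\mathcal P_2(\Omega_L).$$ Local slope of $F:X\to(-\infty,\infty]$ on a metric space $(X,d)$: $|\partial F|(u):=\limsup_{w\to u}\frac{(F(u)-F(w))^+}{d(u,w)}$; here $|\partial J_n|$ is taken in $(\Omega_L^n,d_n)$ and $|\partial\mathcal J|$ in $(\mathcal P_2(\Omega_L),\mathcal W_2)$.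
   Formalization: The formal theorem additionally assumes R(u)=1 for every u in 𝓑; (A1)–(A8) alone do not give this, and without it the claim fails (e.g. ℓ², R the norm, K=0, F=0, 𝓑={u₀} with ‖u₀‖=1/2, n=1: slopes c versus at least 2c). *)

(* Defs.v *)
From HB Require Import structures.
From mathcomp Require Import all_boot all_order all_algebra.
From mathcomp Require Import all_classical all_reals all_analysis.

Set Implicit Arguments.
Unset Strict Implicit.
Unset Printing Implicit Defensive.

Import Order.TTheory GRing.Theory Num.Theory.
Import numFieldNormedType.Exports.

Local Open Scope classical_set_scope.
Local Open Scope ring_scope.

(* The carrier of the topological dual of [V]. Its canonical topology, declared
   below, is the weak-star one, so that [nbhs], [closure], [closed], [compact],
   [continuous] and [-->] on [dual V] refer to the weak-star topology. *)
Section Dual.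
Context {R : realType} (V : normedModType R).

Definition dual_pred : {pred V -> R^o} :=
  fun f => `[< linear f /\ continuous f >].

Lemma dual_submod_closed : submod_closed dual_pred.
Proof.
split=> [|a f g]; first apply/asboolP.
  split; first by move=> a x y; rewrite scaler0 addr0.
  exact: cst_continuous.
move=> /asboolP[lf cf] /asboolP[lg cg]; apply/asboolP; split.
  move=> k x y; rewrite !fctE lf lg scalerDr scalerDr !scalerA mulrC.
  by rewrite addrACA.
by move=> x; apply: cvgD; [apply: cvgZl_tmp; exact: cf|exact: cg].
Qed.

HB.instance Definition _ :=
  GRing.isSubmodClosed.Build _ _ dual_pred dual_submod_closed.

Record dual := Dual { dual_val :> V -> R^o ; dual_valP : dual_val \in dual_pred }.

HB.instance Definition _ := [isSub for dual_val].
HB.instance Definition _ := [Choice of dual by <:].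
HB.instance Definition _ := [SubChoice_isSubLmodule of dual by <:].
HB.instance Definition _ := isPointed.Build dual 0.
HB.instance Definition _ := Topological.copy dual
  (initial_topology (dual_val : dual -> {ptws V -> R^o})).

End Dual.

(* [V] with its weak topology, generated by the elements of [dual V]. *)
Section WeakSpace.
Context {R : realType} (V : normedModType R).

Definition weak_space : Type := V.

Definition weak_eval (y : weak_space) : {ptws dual V -> R^o} :=
  fun phi => phi y.

HB.instance Definition _ := Pointed.copy weak_space V.
HB.instance Definition _ := Topological.copy weak_space
  (initial_topology weak_eval).

End WeakSpace.

Definition separable {T : topologicalType} : Prop :=
  exists S : set T, countable S /\ dense S.
Arguments separable : clear implicits.

Section Functionals.
Context {R : realType}.

(* A Hilbert space is a [completeNormedModType] whose norm comes from an inner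
   product. *)
Definition is_inner_product (Y : normedModType R) (ip : Y -> Y -> R) : Prop :=
  [/\ forall a x y z, ip (a *: x + y) z = a * ip x z + ip y z,
      forall x y, ip x y = ip y x &
      forall x, `|x| ^+ 2 = ip x x].

Definition bounded_below (T : Type) (F : T -> R) : Prop :=
  exists m, forall y, m <= F y.

Definition convex_real (V : lmodType R) (F : V -> R) : Prop :=
  forall (t : R) x y, 0 <= t <= 1 ->
    F (t *: x + (1 - t) *: y) <= t * F x + (1 - t) * F y.

Definition convex_ereal (V : lmodType R) (F : V -> \bar R) : Prop :=
  forall (t : R) x y, 0 <= t <= 1 ->
    (F (t *: x + (1 - t) *: y)%R <= t%:E * F x + (1 - t)%:E * F y)%E.

(* [D2] is the derivative at [y] of ['d F] as a map into the dual of [Y] with the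
   dual norm: the last bound says that the dual norm of
   ['d F (y + h) - 'd F y - D2 h] is at most [e * `|h|]. *)
Definition twice_frechet_differentiable (Y : normedModType R) (F : Y -> R^o) :
    Prop :=
  (forall y, differentiable F y) /\
  forall y, exists D2 : Y -> Y -> R,
    [/\ forall a h h' k, D2 (a *: h + h') k = a * D2 h k + D2 h' k,
        forall a h k k', D2 h (a *: k + k') = a * D2 h k + D2 h k',
        exists c, forall h k, `|D2 h k| <= c * `|h| * `|k| &
        forall e, 0 < e -> \forall h \near (0 : Y), forall k,
          `|'d F (y + h) k - 'd F y k - D2 h k| <= e * `|h| * `|k|].

(* The convention [0 * +oo = 0] of [\bar R] applies at [a = 0]. *)
Definition positively_homogeneous (V : lmodType R) (F : V -> \bar R) : Prop :=
  forall (a : R) u, 0 <= a -> F (a *: u) = (a%:E * F u)%E.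

Definition extreme_points (V : lmodType R) (A : set V) : set V :=
  [set x | A x /\ forall (t : R) y z, A y -> A z -> 0 < t < 1 ->
    x = t *: y + (1 - t) *: z -> y = x /\ z = x].

Definition sublevel (T : Type) (F : T -> \bar R) (a : R) : set T :=
  [set u | (F u <= a%:E)%E].

Definition effective_domain (T : Type) (F : T -> \bar R) : set T :=
  [set u | (F u < +oo)%E].

Definition seq_continuous_on (S T : topologicalType) (D : set S) (f : S -> T) :
    Prop :=
  forall (v : nat -> S) u, (forall k, D (v k)) -> D u ->
    v @ \oo --> u -> (f \o v) @ \oo --> f u.

End Functionals.

Section MetricNotions.
Context {R : realType}.

Definition is_metric (X : Type) (d : X -> X -> R) : Prop :=
  [/\ forall x y, 0 <= d x y, forall x y, d x y = 0 <-> x = y,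
      forall x y, d x y = d y x & forall x y z, d x z <= d x y + d y z].

Definition metric_open (X : Type) (d : X -> X -> R) : set (set X) :=
  [set U | forall x, U x -> exists2 e, 0 < e & [set y | d x y < e] `<=` U].

(* [d] induces the given topology of [X]. *)
Definition metrizes (X : topologicalType) (d : X -> X -> R) : Prop :=
  is_metric d /\
  forall x : X, nbhs x =
    filter_from [set e : R | 0 < e] (fun e => [set y | d x y < e]).

(* Only the values of [g] on [[0, 1]] matter. *)
Definition geodesic (X : Type) (d : X -> X -> R) (g : R -> X) : Prop :=
  forall s t, 0 <= s <= 1 -> 0 <= t <= 1 ->
    d (g s) (g t) = `|s - t| * d (g 0) (g 1).

Definition geodesically_complete (X : Type) (d : X -> X -> R) : Prop :=
  forall x y, exists g, [/\ geodesic d g, g 0 = x & g 1 = y].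

(* limsup over [w -> u] with [w != u], written out as an inf of sups. *)
Definition local_slope (X : Type) (d : X -> X -> R) (F : X -> \bar R) (u : X) :
    \bar R :=
  ereal_inf [set ereal_sup
      [set (maxe (F u - F w) 0 * ((d u w)^-1)%:E)%E | w in
         [set w | 0 < d u w < e]] | e in [set e : R | 0 < e]].

(* Derivative at [t] of a function on [[0, 1]], one-sided at the endpoints. *)
Definition derivative_within01 (f : R -> R) (t l : R) : Prop :=
  (fun s => (f s - f t) / (s - t)) @ within `[0, 1]%classic t^' --> l.

(* Weak derivative of a [Y]-valued curve, i.e. tested against elements of
   [Y]. *)
Definition weak_derivative01 (Y : normedModType R) (ip : Y -> Y -> R)
    (f f' : R -> Y) : Prop :=
  forall z t, 0 <= t <= 1 ->
    derivative_within01 (fun s => ip (f s) z) t (ip (f' t) z).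

End MetricNotions.

(* Measurable types are pointed in MathComp-Analysis; [based x0] is [X] pointed
   at an arbitrary [x0], which plays no other role. *)
Definition based (X : Type) (x0 : X) : Type := X.

Section Based.
Context (X : Type) (x0 : X).
HB.instance Definition _ := gen_eqMixin (based x0).
HB.instance Definition _ := gen_choiceMixin (based x0).
HB.instance Definition _ := isPointed.Build (based x0) x0.
End Based.

(* [X] with the Borel sigma-algebra of the metric [d]. *)
Definition borel {R : realType} (X : Type) (d : X -> X -> R) (x0 : X) :=
  g_sigma_algebraType (metric_open d : set (set (based x0))).

Section Wasserstein.
Context {R : realType} {disp : measure_display} {T : measurableType disp}.

Definition coupling (mu nu : probability T R) :
    set (probability (T * T)%type R) :=
  [set g | forall A, measurable A ->
    g (A `*` setT) = mu A /\ g (setT `*` A) = nu A].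

(* [fine] loses nothing here: [W2] is only used for a bounded [d]. *)
Definition W2 (d : T -> T -> R) (mu nu : probability T R) : R :=
  Num.sqrt (fine (ereal_inf
    [set (\int[g]_z ((d z.1 z.2) ^+ 2)%:E)%E | g in coupling mu nu])).

End Wasserstein.

Section Empirical.
Context {disp : measure_display} {T : measurableType disp} (R : realType).
Context (n : nat) (n_gt0 : (0 < n)%N) (x : 'I_n -> T).
Local Open Scope ereal_scope.

Definition empirical of (0 < n)%N := fun A : set T =>
  ((n%:R : R)^-1)%:E * \sum_(j < n) \d_(x j) A.

Local Notation emp := (empirical n_gt0).

Let emp0 : emp set0 = 0.
Proof. by rewrite /empirical big1 ?mule0// => j _; rewrite dirac0. Qed.

Let emp_ge0 A : 0 <= emp A.
Proof.
apply: mule_ge0; first by rewrite lee_fin invr_ge0 ler0n.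
by apply: sume_ge0 => j _; rewrite diracE lee_fin ler0n.
Qed.

Let emp_sigma_additive : semi_sigma_additive emp.
Proof.
move=> A mA tA mUA; have d0 j i : 0 <= \d_(x j) (A i) :> \bar R.
  by rewrite diracE lee_fin ler0n.
rewrite [X in X @ \oo --> _](_ : _ = fun k => ((n%:R : R)^-1)%:E *
    \sum_(j < n) \sum_(0 <= i < k) \d_(x j) (A i)); last first.
  apply/funext => k; rewrite exchange_big/= ge0_sume_distrr// => i _.
  exact: sume_ge0.
apply: cvgeZl => //; apply: cvg_nnesum => j _.
  by apply: nearW => k; exact: sume_ge0.
exact: (@measure_semi_sigma_additive _ _ R (dirac (x j)) _ mA tA mUA).
Qed.

HB.instance Definition _ := isMeasure.Build _ _ _ emp
  emp0 emp_ge0 emp_sigma_additive.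

Let emp_setT : emp setT = 1.
Proof.
rewrite /empirical (eq_bigr (fun=> 1%R%:E)) => [|j _]; last by rewrite diracT.
by rewrite sumEFin sumr_const card_ord -EFinM mulVf// pnatr_eq0 -lt0n.
Qed.

HB.instance Definition _ := Measure_isProbability.Build _ _ _ emp emp_setT.

End Empirical.

Section Bochner.
Context {R : realType} {disp : measure_display} {T : measurableType disp}.
Context {Y : normedModType R} (mu : probability T R).

Definition simple_integral (s : T -> Y) : Y :=
  \sum_(y \in range s) fine (mu (s @^-1` [set y])) *: y.

Definition is_bochner_integral (f : T -> Y) (I : Y) : Prop :=
  exists s : nat -> {fimfun T >-> Y},
    [/\ forall k y, measurable (s k @^-1` [set y]),
        {ae mu, forall x, (fun k => s k x) @ \oo --> f x},
        (fun k => (\int[mu]_x `|f x - s k x|%:E)%E) @ \oo --> (0 : \bar R) &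
        (fun k => simple_integral (s k)) @ \oo --> I].

Definition bochner_integral (f : T -> Y) : Y :=
  xget 0 [set I | is_bochner_integral f I].

End Bochner.

Section Energies.
Context {R : realType} {C : normedModType R} {Y : normedModType R}.
Context (K : dual C -> Y) (F : Y -> R) (Reg : dual C -> \bar R).

Definition energy (u : dual C) : \bar R := ((F (K u))%:E + Reg u)%E.

Definition unit_ball : set (dual C) := sublevel Reg 1.

(* The weak-star closure of the extremal points of the unit ball of [Reg]. *)
Definition ext_closure : set (dual C) := closure (extreme_points unit_ball).

Context (L : R) (B : set (dual C)) (dB : B -> B -> R).

Definition Omega_n (n : nat) : Type :=
  (('I_n -> `[0, L]%classic) * ('I_n -> B))%type.

Definition d_n (n : nat) (p q : Omega_n n) : R :=
  Num.sqrt (n%:R^-1 * \sum_(j < n)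
    (`|val (p.1 j) - val (q.1 j)| ^+ 2 + dB (p.2 j) (q.2 j) ^+ 2)).

Definition J_n (n : nat) (p : Omega_n n) : \bar R :=
  energy (n%:R^-1 *: \sum_(j < n) val (p.1 j) ^+ 2 *: val (p.2 j)).

(* [Omega_n 1] with its one-element families replaced by their unique member,
   and [d_Omega] is accordingly [d_n] for [n = 1]. *)
Definition Omega : Type := (`[0, L]%classic * B)%type.

Definition d_Omega (p q : Omega) : R :=
  Num.sqrt (`|val p.1 - val q.1| ^+ 2 + dB p.2 q.2 ^+ 2).

(* On the bounded space [Omega] every Borel probability measure has a finite
   second moment. *)
Definition P2 (w0 : Omega) : Type := probability (borel d_Omega w0) R.

Definition lifted_energy (w0 : Omega) (nu : P2 w0) : \bar R :=
  ((F (bochner_integral nu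
        (fun w : Omega => val w.1 ^+ 2 *: K (val w.2))))%:E
   + \int[nu]_w (val (w : Omega).1 ^+ 2)%:E)%E.

Definition atoms (w0 : Omega) (n : nat) (p : Omega_n n) :
    'I_n -> borel d_Omega w0 := fun j => (p.1 j, p.2 j).

Definition empirical_measure (w0 : Omega) (n : nat) (n_gt0 : (0 < n)%N)
    (p : Omega_n n) : P2 w0 :=
  empirical R (atoms w0 p) n_gt0.

Definition slope_lifted (w0 : Omega) : P2 w0 -> \bar R :=
  local_slope (W2 (d_Omega : borel d_Omega w0 -> borel d_Omega w0 -> R))
    (@lifted_energy w0).

Definition slope_n (n : nat) : Omega_n n -> \bar R :=
  local_slope (@d_n n) (@J_n n).

Definition no_loss_of_mass : Prop :=
  forall n (a : 'I_n -> R) (u : 'I_n -> dual C),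
    (forall j, 0 <= a j) -> (forall j, B (u j)) ->
    Reg (\sum_(j < n) a j *: u j) = (\sum_(j < n) (a j)%:E * Reg (u j))%E.

(* Nonzero extremal points of [unit_ball] have [Reg u = 1], but a weak-star limit
   of them may have [Reg u < 1]. The term [c ^ 2] of [lifted_energy] lifts
   [c ^ 2 * Reg u] only when [Reg] is [1] on [B]. *)
Definition unit_mass : Prop := forall u, B u -> Reg u = 1%E.

Definition geodesic_derivative_bound (ip : Y -> Y -> R) : Prop :=
  exists2 c : R, 0 < c & forall g : R -> B, geodesic dB g ->
    exists D1 D2 : R -> Y,
      [/\ weak_derivative01 ip (fun t => K (val (g t))) D1,
          weak_derivative01 ip D1 D2 &
          forall t, 0 <= t <= 1 ->
            `|D1 t| <= c * dB (g 0) (g 1) /\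
            `|D2 t| <= c * dB (g 0) (g 1) ^+ 2].

End Energies.

(* Main.v *)
(* Along geodesics of Omega the maps c^2 K u and c^2 are affine up to an error
   t d^2, by (A8). Write S for the slope of J_n at p, I for the integral of c^2 K u
   against mu, and phi := dF(I)(c^2 K u) + c^2. Letting t tend to 0 along geodesics
   from p to an arbitrary y turns the local information S into the global bound
     1/n sum_j (phi(x_j) - phi(y_j)) <= S d_n(p, y) + M d_n(p, y)^2.
   Young's inequality applied to S d_n makes the right-hand side a sum over j, so
   that the bound passes to the infimal convolution of phi with N d^2, and the easy
   half of Kantorovich duality gives, with no optimal plan or disintegration,
     J(mu) - J(nu) <= int phi dmu - int phi dnu <= S W_2(mu, nu) + M W_2(mu, nu)^2,
   where the first step is the convexity of F. Hence the lifted slope is at most S.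
   Conversely W_2(mu_p, mu_q) <= d_n(p, q), so competitors for J_n are competitors
   for the lifted energy with a larger difference quotient. *)

From HB Require Import structures.
Require Import Defs.
From mathcomp Require Import all_boot all_order all_algebra.
From mathcomp Require Import all_classical all_reals all_analysis.
From mathcomp Require Import finmap measurable_realfun ring lra.

Set Implicit Arguments.
Unset Strict Implicit.

Import Order.TTheory GRing.Theory Num.Theory.
Import numFieldNormedType.Exports.

Local Open Scope classical_set_scope.
Local Open Scope ring_scope.

(** The argument lives on a totally bounded metric space [X] with two Lipschitz maps, [G] (for c^2 K
    u) and [s] (for c^2). Geodesics enter only through [almost_geodesic]: its errors carry a factor
    [t], so that they stay quadratic in [d] after division by [t]. The points it supplies are chosen
    above the n atoms only, where finite choice suffices although [nu] is arbitrary.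

    Two degeneracies shape the statements. A supremum over no competitor is -oo, so both slopes need
    points at arbitrarily small positive distance; moving one mass coordinate supplies them. Pairs
    of measures at [W2] distance 0 are invisible to the slope; their energies are compared through
    integrals of Lipschitz functions and the convexity of [F].

    The cost [d ^+ 2] is not assumed measurable for the product sigma-algebra, so its integral is
    compared with others as a supremum over simple functions. *)

(** * Integrals of empirical measures and transport duality *)

Section Integrals.
Context {R : realType} {disp : measure_display} {T : measurableType disp}.
Local Open Scope ereal_scope.

Import HBNNSimple.

(* The integral of a nonnegative function is a supremum over simple functions
   below it, so that [f] and [g] need not be measurable. *)
Lemma ge0_le_integral_nomeas (mu : {measure set T -> \bar R}) (f g : T -> \bar R) :
  (forall x, 0 <= f x) -> (forall x, f x <= g x) ->
  \int[mu]_x f x <= \int[mu]_x g x.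
Proof.
move=> f0 fg; have g0 x : 0 <= g x by exact: le_trans (fg x).
rewrite !ge0_integralTE//; apply: ereal_sup_le => _ [h hf <-].
by exists h => // x; exact: le_trans (fg x).
Qed.

Lemma ge0_integral_le_cst (mu : probability T R) (f : T -> \bar R) (c : \bar R) :
  (forall x, 0 <= f x) -> (forall x, f x <= c) -> \int[mu]_x f x <= c.
Proof.
move=> f0 fc; apply: le_trans (ge0_le_integral_nomeas mu f0 fc) _.
by rewrite integral_cst// [X in (_ * X)%E](probability_setT mu) mule1.
Qed.

Lemma bounded_integrable (mu : probability T R) (f : T -> R) (M : R) :
  measurable_fun setT f -> (forall x, `|f x| <= M)%R ->
  mu.-integrable setT (EFin \o f).
Proof.
move=> mf fM; apply: measurable_bounded_integrable => //.
  exact: le_lt_trans (probability_le1 mu measurableT) (ltry _).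
exists M; split; first exact: num_real.
by move=> y My x _; apply: le_trans (fM x) (ltW My).
Qed.

End Integrals.

Section EmpiricalIntegral.
Context {R : realType} {disp : measure_display} {T : measurableType disp}.
Context (n : nat) (n_gt0 : (0 < n)%N) (x : 'I_n -> T).
Local Open Scope ereal_scope.

Import HBNNSimple.

Local Notation emp := (empirical R x n_gt0).

Lemma ge0_integral_empirical (f : T -> \bar R) :
  measurable_fun setT f -> (forall t, 0 <= f t) ->
  \int[emp]_t f t = (n%:R^-1 : R)%:E * \sum_(j < n) f (x j).
Proof.
move=> mf f0.
have n0 : (0 <= n%:R^-1 :> R)%R by rewrite invr_ge0.
(* [msum] runs over naturals: the Dirac masses are padded with the zero measure beyond [n]. *)
pose m (k : nat) : {measure set T -> \bar R} :=
  if insub k is Some j then \d_(x j) else mzero.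
pose s := msum m n.
rewrite (eq_measure_integral (mscale (NngNum n0) s)); last first.
  move=> A mA _; rewrite /= /mscale/= /empirical; congr (_ * _).
  by apply: eq_bigr => j _; rewrite /m valK.
rewrite ge0_integral_mscale// ge0_integral_measure_sum//; congr (_ * _).
by apply: eq_bigr => j _; rewrite /m valK integral_dirac// diracT mul1e.
Qed.

(** Without measurability of [g] one inequality survives, because the simple functions below [g] are
    measurable. It serves the cost [d ^+ 2] in [W2_empirical_le]. *)
Lemma ge0_integral_empirical_le (g : T -> \bar R) : (forall t, 0 <= g t) ->
  \int[emp]_t g t <= (n%:R^-1 : R)%:E * \sum_(j < n) g (x j).
Proof.
move=> g0; rewrite ge0_integralTE//; apply/ge_ereal_sup => _ [h hg <-].
have -> : sintegral emp h = \int[emp]_t (h t)%:E.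
  by rewrite integral_nnsfun// patch_setT.
rewrite ge0_integral_empirical//.
- by apply: lee_wpmul2l; [rewrite lee_fin invr_ge0|exact: lee_sum].
- exact/measurable_EFinP.
- by move=> t; rewrite lee_fin.
Qed.

Lemma Rintegral_empirical (f : T -> R) (M : R) :
  measurable_fun setT f -> (forall t, `|f t| <= M)%R ->
  (\int[emp]_t f t = n%:R^-1 * \sum_(j < n) f (x j))%R.
Proof.
move=> mf fM.
have n0 : n%:R != 0%R :> R by rewrite pnatr_eq0 -lt0n.
have g0 t : (0 <= f t + M)%R.
  by have := fM t; rewrite ler_norml => /andP[? _]; rewrite -lerBlDr sub0r.
have ifin := bounded_integrable emp mf fM.
have icst : emp.-integrable setT (EFin \o cst M).
  by apply: (bounded_integrable emp (M := `|M|)).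
(* Adding the bound [M] reduces to the nonnegative case; it is cancelled at the end. *)
have : (\int[emp]_t (f t + M) = n%:R^-1 * \sum_(j < n) (f (x j) + M))%R.
  rewrite /Rintegral ge0_integral_empirical ?sumEFin//.
  by apply/measurable_EFinP; exact: measurable_funD.
rewrite RintegralD// Rintegral_cst// [fine _](_ : _ = 1%R); last by rewrite [X in fine X](probability_setT emp).
rewrite mulr1 big_split/=.
by rewrite sumr_const card_ord mulrDr -(mulr_natl M) mulrA mulVf// mul1r => /addIr.
Qed.

End EmpiricalIntegral.

Section WassersteinDuality.
Context {R : realType} {disp : measure_display} {T : measurableType disp}.
Context (d : T -> T -> R) (D : R).
Context (d_ge0 : forall x y, 0 <= d x y).
Context (d_le : forall x y, d x y <= D).
Implicit Types mu nu : probability T R.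

Lemma coupling_fst mu nu g (f : T -> R) M : coupling mu nu g ->
  measurable_fun setT f -> (forall x, `|f x| <= M) ->
  \int[g]_z f z.1 = \int[mu]_x f x.
Proof.
move=> cg mf fM; rewrite /Rintegral; congr fine.
rewrite -(integral_pushforward (phi := fst) (f := EFin \o f) _ (mu := g) (D := setT))//; last 2 first.
- exact/measurable_EFinP.
- apply: (bounded_integrable g (M := M)) => //.
  exact: measurableT_comp.
apply: eq_measure_integral => A mA _.
apply: etrans (proj1 (cg _ mA)); rewrite /pushforward; congr (g _).
by apply/seteqP; split => -[a b]//= [].
Qed.

Lemma coupling_snd mu nu g (f : T -> R) M : coupling mu nu g ->
  measurable_fun setT f -> (forall x, `|f x| <= M) ->
  \int[g]_z f z.2 = \int[nu]_x f x.
Proof.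
move=> cg mf fM; rewrite /Rintegral; congr fine.
rewrite -(integral_pushforward (phi := snd) (f := EFin \o f) _ (mu := g) (D := setT))//; last 2 first.
- exact/measurable_EFinP.
- apply: (bounded_integrable g (M := M)) => //.
  exact: measurableT_comp.
apply: eq_measure_integral => A mA _.
apply: etrans (proj2 (cg _ mA)); rewrite /pushforward; congr (g _).
by apply/seteqP; split => -[a b]//= [].
Qed.

(** Gives the infimum defining [W2] a competitor, whose cost is at most [D ^+ 2]. *)
Lemma coupling_product mu nu : coupling mu nu (mu \x nu)%E.
Proof.
move=> A mA; split.
  apply: etrans (product_measure1E mu nu mA measurableT) _.
  by rewrite [X in (_ * X)%E](probability_setT nu) mule1.
apply: etrans (product_measure1E mu nu measurableT mA) _.
by rewrite [X in (X * _)%E](probability_setT mu) mul1e.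
Qed.

Lemma W2_ge0 mu nu : 0 <= W2 d mu nu.
Proof. exact: sqrtr_ge0. Qed.

(** The infimum lies between 0 and [D ^+ 2], so neither [fine] nor the square root loses
    anything. *)
Lemma W2_sqrE mu nu : ((W2 d mu nu ^+ 2)%:E = ereal_inf
  [set (\int[g]_z ((d z.1 z.2) ^+ 2)%:E)%E | g in coupling mu nu])%E.
Proof.
set I := ereal_inf _.
have I0 : (0 <= I)%E.
  apply: le_ereal_inf_tmp => _ [g _ <-]; apply: integral_ge0 => z _.
  by rewrite lee_fin sqr_ge0.
have ID : (I <= (D ^+ 2)%:E)%E.
  apply: ge_ereal_inf; eexists; first by exists (mu \x nu)%E; [exact: coupling_product|].
  apply: ge0_integral_le_cst => z; rewrite lee_fin ?sqr_ge0//.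
  by rewrite ler_sqr ?nnegrE ?d_le// (le_trans (d_ge0 z.1 z.2)).
rewrite /W2 sqr_sqrtr ?fine_ge0// fineK// ge0_fin_numE//.
exact: le_lt_trans ID (ltry _).
Qed.

Lemma W2_sqr_le mu nu g : coupling mu nu g ->
  ((W2 d mu nu ^+ 2)%:E <= \int[g]_z ((d z.1 z.2) ^+ 2)%:E)%E.
Proof. by move=> cg; rewrite W2_sqrE; apply: ereal_inf_lbound; exists g. Qed.

Lemma W2_sqr_ge mu nu r :
  (forall g, coupling mu nu g ->
    r%:E <= \int[g]_z ((d z.1 z.2) ^+ 2)%:E)%E -> r <= W2 d mu nu ^+ 2.
Proof.
move=> h; rewrite -lee_fin W2_sqrE; apply: le_ereal_inf_tmp => _ [g cg <-].
exact: h.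
Qed.

(** Weak duality: the constraint is integrated against each coupling, whose marginals turn [f z.1]
    and [h z.2] into the two integrals. *)
Lemma W2_duality mu nu (f h : T -> R) M N : 0 < N ->
  measurable_fun setT f -> (forall x, `|f x| <= M) ->
  measurable_fun setT h -> (forall x, `|h x| <= M) ->
  (forall x y, f x - h y <= N * d x y ^+ 2) ->
  \int[mu]_x f x - \int[nu]_x h x <= N * W2 d mu nu ^+ 2.
Proof.
move=> N0 mf fM mh hM fh.
rewrite mulrC -ler_pdivrMr//; apply: W2_sqr_ge => g cg.
have mf1 : measurable_fun setT (fun z : T * T => f z.1) by exact: measurableT_comp.
have mh2 : measurable_fun setT (fun z : T * T => h z.2) by exact: measurableT_comp.
have if1 : g.-integrable setT (EFin \o (fun z : T * T => f z.1)).
  exact: (bounded_integrable g (M := M)).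
have ih2 : g.-integrable setT (EFin \o (fun z : T * T => h z.2)).
  exact: (bounded_integrable g (M := M)).
rewrite -(coupling_fst cg mf fM) -(coupling_snd cg mh hM).
rewrite -RintegralB//.
(* A measurable function between [(f z.1 - h z.2) / N] and [d ^+ 2], nonnegative as
   [ge0_le_integral_nomeas] requires. *)
pose k z := Num.max 0 ((f z.1 - h z.2) / N).
have ifh : g.-integrable setT (EFin \o (fun z => f z.1 - h z.2)).
  apply: (bounded_integrable g (M := M + M)); first exact: measurable_funB.
  by move=> z; apply: le_trans (ler_normB _ _) _; exact: lerD.
have mk : measurable_fun setT k.
  apply: measurable_maxr => //; apply: measurable_funM => //.
  exact: measurable_funB.
have M0 : 0 <= M by apply: le_trans (fM point).
have kM z : `|k z| <= (M + M) / N.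
  rewrite ger0_norm ?le_max ?lexx// /k ge_max; apply/andP; split.
    by rewrite divr_ge0 ?addr_ge0// ltW.
  rewrite ler_pM2r ?invr_gt0//; apply: le_trans (ler_norm _) _.
  by apply: le_trans (ler_normB _ _) _; exact: lerD.
apply: (@le_trans _ _ (\int[g]_z (k z)%:E)%E).
  have -> : (\int[g]_z (k z)%:E)%E = (\int[g]_z k z)%:E.
    rewrite fineK//; apply: integrable_fin_num => //.
    exact: (bounded_integrable g mk kM).
  rewrite lee_fin ler_pdivrMr// mulrC -RintegralZl//; last first.
    exact: (bounded_integrable g mk kM).
  apply: le_Rintegral => //.
    apply: (bounded_integrable g (M := N * ((M + M) / N))).
      exact: measurable_funM.
    by move=> z; rewrite normrM (gtr0_norm N0) ler_pM2l.
  move=> z _; rewrite -ler_pdivrMl// mulrC /k le_max lexx orbT//.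
apply: ge0_le_integral_nomeas => z; rewrite lee_fin.
  by rewrite /k le_max lexx.
rewrite /k ge_max sqr_ge0/= ler_pdivrMr// mulrC; exact: fh.
Qed.

(** The empirical measure of the pairs [(x j, y j)] is a coupling. *)
Lemma W2_empirical_le (n : nat) (n_gt0 : (0 < n)%N) (x y : 'I_n -> T) :
  W2 d (empirical R x n_gt0) (empirical R y n_gt0) <=
  Num.sqrt (n%:R^-1 * \sum_(j < n) d (x j) (y j) ^+ 2).
Proof.
have S0 : 0 <= n%:R^-1 * \sum_(j < n) d (x j) (y j) ^+ 2.
  by rewrite mulr_ge0 ?invr_ge0// sumr_ge0// => j _; exact: sqr_ge0.
rewrite -(@ler_sqr _ (W2 _ _ _)) ?nnegrE ?sqrtr_ge0 ?W2_ge0//.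
rewrite [leRHS]sqr_sqrtr// -lee_fin.
pose g : probability (T * T)%type R := empirical R (fun j => (x j, y j)) n_gt0.
apply: le_trans (W2_sqr_le (g := g) _) _.
  move=> A mA; rewrite /g /= /empirical; split; congr (_ * _)%E;
  by apply: eq_bigr => j _; rewrite !diracE; congr (_%:R%:E)%E;
    rewrite in_setX/= ?in_setT ?andbT.
apply: le_trans.
  by apply: ge0_integral_empirical_le => z; rewrite lee_fin sqr_ge0.
by rewrite sumEFin -EFinM.
Qed.

End WassersteinDuality.

(** * Bochner integrals over a totally bounded metric space *)

Section InnerProduct.
Context {R : realType} {Y : normedModType R} {ip : Y -> Y -> R}.
Context (ip_inner : is_inner_product ip).

Lemma ip_linear z a x y : ip (a *: x + y) z = a * ip x z + ip y z.
Proof. by have [/(_ a x y z)] := ip_inner. Qed.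

Lemma ip_norm x : ip x x = `|x| ^+ 2.
Proof. by have [_ _ ->] := ip_inner. Qed.

Lemma ip_sym x y : ip x y = ip y x.
Proof. by have [_ ->] := ip_inner. Qed.

Lemma ip0l z : ip 0 z = 0.
Proof.
have := ip_linear z 1 0 0; rewrite scaler0 addr0 mul1r => h.
by apply: (addrI (ip 0 z)); rewrite -h addr0.
Qed.

Lemma ipBl z x y : ip (x - y) z = ip x z - ip y z.
Proof. by rewrite -scaleN1r addrC ip_linear mulN1r addrC. Qed.

Lemma ipZl z a x : ip (a *: x) z = a * ip x z.
Proof. by rewrite -[a *: x]addr0 ip_linear ip0l addr0. Qed.

Lemma ip_cauchy_schwarz x z : `|ip x z| <= `|x| * `|z|.
Proof.
have [->|z0] := eqVneq z 0; first by rewrite ip_sym ip0l !normr0 mulr0.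
have nz : 0 < `|z| ^+ 2 by rewrite exprn_gt0// normr_gt0.
rewrite -ler_sqr ?nnegrE ?mulr_ge0// real_normK ?num_real// exprMn.
pose t := ip x z / `|z| ^+ 2.
have : 0 <= ip (x - t *: z) (x - t *: z) by rewrite ip_norm sqr_ge0.
rewrite ipBl ipZl ![ip _ (x - _)]ip_sym !ipBl !ipZl (ip_sym z x) !ip_norm.
have tz : t * `|z| ^+ 2 = ip x z by rewrite /t divfK ?gt_eqF.
rewrite tz subrr mulr0 subr0 subr_ge0 => h.
have : t * ip x z * `|z| ^+ 2 <= `|x| ^+ 2 * `|z| ^+ 2 by rewrite ler_pM2r.
by rewrite mulrAC tz -expr2.
Qed.

(** This is how scalar estimates, available for each [z] from integrals and weak derivatives, become
    norm estimates; [z = x] is the decisive test. *)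
Lemma ip_norm_le x c : 0 <= c -> (forall z, ip x z <= c * `|z|) -> `|x| <= c.
Proof.
move=> c0 /(_ x); rewrite ip_norm expr2.
have [->|x0] := eqVneq x 0; first by rewrite normr0.
by rewrite ler_pM2r// normr_gt0.
Qed.

End InnerProduct.

Section SimpleIntegral.
Context {R : realType} {disp : measure_display} {T : measurableType disp}.
Context {Y : normedModType R} (mu : probability T R).
Context (l : Y -> R).
Context (l_linear : forall a x y, l (a *: x + y) = a * l x + l y).

Let l0 : l 0 = 0.
Proof.
have := l_linear 1 0 0; rewrite scaler0 addr0 mul1r => h.
by apply: (addrI (l 0)); rewrite -h addr0.
Qed.

Lemma Rintegral_sum_integrable (I : Type) (r : seq I) (f : I -> T -> R) :
  (forall i, mu.-integrable setT (EFin \o f i)) ->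
  mu.-integrable setT (EFin \o (fun x => \sum_(i <- r) f i x)) /\
  \int[mu]_x (\sum_(i <- r) f i x) = \sum_(i <- r) \int[mu]_x f i x.
Proof.
move=> fi; elim: r => [|i r [ih1 ih2]].
  rewrite big_nil; under eq_Rintegral do rewrite big_nil.
  rewrite Rintegral_cst// mul0r; split=> //.
  rewrite (_ : _ \o _ = cst 0%E); first exact: integrable0.
  by apply/funext => x /=; rewrite big_nil.
rewrite big_cons -ih2 -RintegralD//; split.
  rewrite (_ : _ \o _ = (EFin \o f i) \+ (EFin \o fun x => \sum_(j <- r) f j x)).
    exact: integrableD.
  by apply/funext => x /=; rewrite big_cons EFinD.
by apply: eq_Rintegral => x _; rewrite big_cons.
Qed.

Lemma Rintegral_simple (s : {fimfun T >-> Y}) :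
  (forall y, measurable (s @^-1` [set y])) ->
  mu.-integrable setT (EFin \o (l \o s)) /\
  \int[mu]_x l (s x) = l (simple_integral mu s).
Proof.
move=> ms; have fs : finite_set (range s) by exact: fimfunP.
rewrite /simple_integral fsbig_finite//=.
set r := fset_set (range s).
have lsum (c : Y -> R) : l (\sum_(y <- r) c y *: y) = \sum_(y <- r) c y * l y.
  elim/big_rec2 : _ => [//|y a b _ <-]; exact: l_linear.
rewrite lsum.
have lE x : l (s x) = \sum_(y <- r) l y * \1_(s @^-1` [set y]) x.
  rewrite (bigD1_seq (s x))/=; last 2 first.
  - by rewrite in_fset_set//; apply/mem_set; exists x.
  - exact: fset_uniq.
  rewrite indicE mem_set// mulr1 big1 ?addr0// => y ysx.
  by rewrite indicE memNset ?mulr0// => /esym/eqP; apply/negP.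
have iI y : mu.-integrable setT (EFin \o (\1_(s @^-1` [set y]) : T -> R)).
  apply: (bounded_integrable mu (M := 1)); first exact: measurable_indic.
  by move=> x; rewrite indicE; case: (_ \in _); rewrite ?normr0 ?normr1.
have ii y : mu.-integrable setT
    (EFin \o (fun x => l y * \1_(s @^-1` [set y]) x)).
  rewrite (_ : _ \o _ = fun x => ((l y)%:E * (\1_(s @^-1` [set y]) x)%:E)%E).
    exact: (integrableZl measurableT (l y) (iI y)).
  by apply/funext => x /=; rewrite EFinM.
have [i1 i2] := Rintegral_sum_integrable r ii.
split.
  by rewrite (_ : _ \o _ = EFin \o (fun x =>
    \sum_(y <- r) l y * \1_(s @^-1` [set y]) x))//; apply/funext => x /=; rewrite lE.
under eq_Rintegral do rewrite lE.
rewrite i2; apply: eq_bigr => y _; rewrite RintegralZl// mulrC; congr (_ * _).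
by rewrite /Rintegral integral_indic// setIT.
Qed.

(** Both sides are limits of their values at the simple functions [s k], where the formula is
    [Rintegral_simple]. Every candidate [I] is covered, hence also the one that [xget] picks. *)
Lemma bochner_linear (f : T -> Y) (I : Y) (c : R) :
  0 < c -> (forall x, `|l x| <= c * `|x|) ->
  mu.-integrable setT (EFin \o (l \o f)) ->
  is_bochner_integral mu f I -> l I = \int[mu]_x l (f x).
Proof.
move=> c0 lc lfi [s [ms _ cvg1 cvg2]].
have lB x y : l (x - y) = l x - l y.
  by rewrite -scaleN1r addrC l_linear mulN1r addrC.
apply/eqP; rewrite -subr_eq0 -normr_le0; apply/ler_addgt0Pl => e e0; rewrite addr0.
(* There will be two errors, each at most [c * a = e / 2]. *)
pose a := e / (c + c); have a0 : 0 < a by rewrite divr_gt0// addr_gt0.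
have [k [k1 k2]] : exists k, `|I - simple_integral mu (s k)| < a /\
    (\int[mu]_x `|f x - s k x|%:E <= a%:E)%E.
  have e1 : \forall k \near \oo, `|I - simple_integral mu (s k)| < a.
    by move/cvgrPdist_lt : cvg2; apply.
  have e2 : \forall k \near \oo, (\int[mu]_x `|f x - s k x|%:E <= a%:E)%E.
    have /= := cvg1 [set x | (x < a%:E)%E] _; move=> /(_ _)[].
      by apply: open_nbhs_nbhs; split; [exact: open_ereal_lt_ereal|rewrite /= lte_fin].
    move=> N _ h; exists N => // k /h /=; exact: ltW.
  have [N _ h] : \forall k \near \oo, `|I - simple_integral mu (s k)| < a /\
    (\int[mu]_x `|f x - s k x|%:E <= a%:E)%E by near=> k; split; near: k.
  by exists N; exact: (h N (leqnn N)).
have [i1 i2] := Rintegral_simple (ms k).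
have -> : l I - \int[mu]_x l (f x) = l (I - simple_integral mu (s k)) +
    (\int[mu]_x l (s k x) - \int[mu]_x l (f x)).
  by rewrite lB i2; ring.
rewrite -RintegralB//.
have iB : mu.-integrable setT (EFin \o (fun x => l (s k x) - l (f x))).
  rewrite (_ : _ \o _ = (EFin \o (l \o s k)) \- (EFin \o (l \o f)))%E.
    exact: integrableB.
  by apply/funext => x /=; rewrite EFinB.
have iA : mu.-integrable setT (EFin \o (fun x => `|l (s k x) - l (f x)|)).
  by have := integrable_norm iB.
have i3 : `|\int[mu]_x (l (s k x) - l (f x))| <= c * a.
  apply: le_trans (le_normr_Rintegral _ iB) _ => //.
  rewrite mulrC -ler_pdivrMr// mulrC -RintegralZl// -lee_fin.
  have iM : mu.-integrable setT (EFin \o (fun x => c^-1 * `|l (s k x) - l (f x)|)).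
    rewrite (_ : _ \o _ = (fun x => c^-1%:E * `|l (s k x) - l (f x)|%:E)%E).
      exact: (integrableZl measurableT c^-1 iA).
    by apply/funext => x /=; rewrite EFinM.
  rewrite fineK; last exact: integrable_fin_num.
  apply: le_trans k2; apply: ge0_le_integral_nomeas => x.
    by rewrite lee_fin mulr_ge0// invr_ge0 ltW.
  by rewrite lee_fin ler_pdivrMl// distrC -lB.
apply: le_trans (ler_normD _ _) _.
have -> : e = c * a + c * a by rewrite -mulrDl mulrC divfK// gt_eqF// addr_gt0.
apply: lerD => //; apply: le_trans (lc _) _.
by rewrite ler_pM2l// ltW.
Unshelve. all: by end_near. Qed.

End SimpleIntegral.

Section BorelMetric.
Context {R : realType} {X : Type} (d : X -> X -> R) (w0 : X).
Context (d_metric : is_metric d).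
Local Notation T := (borel d w0).

Definition lipschitz_fun (f : X -> R) :=
  exists k, forall x y, `|f x - f y| <= k * d x y.

Definition totally_bounded_metric :=
  forall e, 0 < e -> exists s : seq X, forall x, has (fun v => d x v < e) s.

Lemma metric_open_measurable (U : set X) :
  metric_open d U -> measurable (U : set T).
Proof. by move=> oU; exact: sub_sigma_algebra. Qed.

Lemma measurable_metric_ball a e : measurable ([set x | d x a < e] : set T).
Proof.
have [_ _ dC dtri] := d_metric.
apply: metric_open_measurable => x /= xe.
exists (e - d x a); first by rewrite subr_gt0.
move=> y /= xy; apply: le_lt_trans (dtri y x a) _.
by rewrite -ltrBrDr dC.
Qed.

Lemma measurable_lipschitz f : lipschitz_fun f ->
  measurable_fun setT (f : T -> R).
Proof.
move=> [k fk]; have [d0 _ dC _] := d_metric.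
pose K := Num.max k 1; have K0 : 0 < K by rewrite lt_max ltr01 orbT.
apply: (measurability _ (RGenOInfty.measurableE R)) => _ [_ [a ->] <-].
rewrite setTI; apply: metric_open_measurable => x /=.
rewrite in_itv/= andbT => afx.
exists ((f x - a) / K); first by rewrite divr_gt0// subr_gt0.
move=> y /=; rewrite ltr_pdivlMr// in_itv/= andbT => xy.
have /ler_normlW : `|f x - f y| <= K * d x y.
  by apply: le_trans (fk x y) _; rewrite ler_wpM2r// le_max lexx.
rewrite mulrC => h; have := le_lt_trans h xy.
by rewrite ltrD2l ltrN2.
Qed.

(** [find] returns the first ball of the list that contains [x]. Its level sets are finite Boolean
    combinations of balls, the measurable partition behind [fimfun_approx]. *)
Lemma measurable_find_ball e (s : seq X) (A : set nat) :
  measurable ([set x | A (find (fun v => d x v < e) s)] : set T).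
Proof.
elim: s A => [|v s ih] A.
  have [A0|A0] := pselect (A 0%N).
    by rewrite (_ : mkset _ = setT)//; apply/seteqP; split.
  by rewrite (_ : mkset _ = set0)//; apply/seteqP; split.
rewrite (_ : mkset _ =
    ([set x | d x v < e] `&` [set x | A 0%N]) `|`
    (~` [set x | d x v < e] `&`
      [set x | (fun i => A i.+1) (find (fun v => d x v < e) s)])); last first.
  apply/seteqP; split => x /=; case: ifPn => xv.
  - by left.
  - by right; split=> //; exact/negP.
  - by move=> [[]|[]].
  - by move=> [[]|[]]//.
apply: measurableU; apply: measurableI.
- exact: measurable_metric_ball.
- have [A0|A0] := pselect (A 0%N).
    by rewrite (_ : mkset _ = setT)//; apply/seteqP; split.
  by rewrite (_ : mkset _ = set0)//; apply/seteqP; split.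
- by apply: measurableC; exact: measurable_metric_ball.
- exact: (ih (fun i => A i.+1)).
Qed.

Context (tb : totally_bounded_metric).

Section BochnerExistence.
Context {Y : completeNormedModType R} {ip : Y -> Y -> R}.
Context (ip_inner : is_inner_product ip).
Context (G : X -> Y) (La : R) (G_lip : forall x y, `|G x - G y| <= La * d x y).

(** [G] is frozen at the centre of the first ball of radius [e / K] that contains the point; the
    approximation is uniform. *)
Lemma fimfun_approx e : 0 < e -> exists s : {fimfun T >-> Y},
  (forall y, measurable (s @^-1` [set y])) /\ forall x, `|G x - s x| <= e.
Proof.
have [d0 _ _ _] := d_metric.
move=> e0; pose K := Num.max La 1; have K0 : 0 < K by rewrite lt_max ltr01 orbT.
have [l hl] := tb (divr_gt0 e0 K0).
pose i x := find (fun v => d x v < e / K) l.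
pose f (x : T) := G (nth w0 l (i x)).
have ff : finite_set (range f).
  (* A priori [find] may return [size l], where [nth] gives [w0]; hence the successor. *)
  apply: (@sub_finite_set _ _ ((fun k => G (nth w0 l k)) @` `I_(size l).+1)).
    by move=> _ [x _ <-]; exists (i x) => //=; rewrite ltnS find_size.
  by apply: finite_image; exact: finite_II.
pose m := FiniteImage.Build T Y f ff.
pose s : {fimfun T >-> Y} := HB.pack f m.
exists s; split=> [y|x].
  exact: (measurable_find_ball (e / K) l [set k | G (nth w0 l k) = y]).
apply: le_trans (G_lip x _) _.
have /(nth_find w0) h := hl x.
apply: (@le_trans _ _ (K * d x (nth w0 l (i x)))).
  by rewrite ler_wpM2r// le_max lexx.
by rewrite mulrC -ler_pdivlMr// ltW.
Qed.

(** Uniformly close simple functions have close integrals, as testing with the inner product shows;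
    the sequence is Cauchy and [Y] is complete. *)
Lemma bochner_exists (nu : probability T R) :
  exists I, is_bochner_integral nu (G : T -> Y) I.
Proof.
have /choice[s hs] : forall k : nat, exists s : {fimfun T >-> Y},
    (forall y, measurable (s @^-1` [set y])) /\ forall x, `|G x - s x| <= k.+1%:R^-1.
  by move=> k; apply: fimfun_approx; rewrite invr_gt0.
have ips z : forall a x y, ip (a *: x + y) z = a * ip x z + ip y z.
  by move=> a x y; exact: ip_linear.
have dist k j : `|simple_integral nu (s k) - simple_integral nu (s j)| <=
    k.+1%:R^-1 + j.+1%:R^-1.
  apply: (ip_norm_le ip_inner) => [|z]; first by rewrite addr_ge0// invr_ge0.
  have [i1 e1] := Rintegral_simple nu (ips z) (proj1 (hs k)).
  have [i2 e2] := Rintegral_simple nu (ips z) (proj1 (hs j)).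
  rewrite (ipBl ip_inner) -e1 -e2 -RintegralB//.
  set c := (_ + _) * _.
  have -> : c = \int[nu]_x (cst c x).
    rewrite Rintegral_cst//.
    by rewrite [X in fine X](probability_setT nu) mulr1.
  apply: le_Rintegral => //.
  - rewrite (_ : _ \o _ = (EFin \o ((ip^~ z) \o s k)) \- (EFin \o ((ip^~ z) \o s j)))%E.
      exact: integrableB.
    by apply/funext => x /=; rewrite EFinB.
  - by apply: (bounded_integrable nu (M := `|c|)).
  - move=> x _; rewrite /c -(ipBl ip_inner).
    apply: le_trans (ler_norm _) _; apply: le_trans (ip_cauchy_schwarz ip_inner _ _) _.
    rewrite ler_wpM2r//.
    have -> : s k x - s j x = (s k x - G x) + (G x - s j x) by rewrite addrA subrK.
    apply: le_trans (ler_normD _ _) _; rewrite distrC.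
    by apply: lerD; [exact: (proj2 (hs k))|exact: (proj2 (hs j))].
have inv0 e : 0 < e -> \forall k \near \oo, k.+1%:R^-1 < e :> R.
  by move=> e0; exact: (near_infty_natSinv_lt (PosNum e0)).
have cv : cvg (simple_integral nu (s k) @[k --> \oo]).
  apply/cauchy_cvgP/cauchy_ballP => e e0; near_simpl.
  have e2 : 0 < e / 2 by rewrite divr_gt0.
  near=> k j; rewrite -ball_normE /=.
  apply: le_lt_trans (dist _ _) _; rewrite [e in _ < e]splitr; apply: ltrD.
    by near: k; exact: inv0.
  by near: j; exact: inv0.
exists (lim (simple_integral nu (s k) @[k --> \oo])), s; split.
- by move=> k y; exact: (proj1 (hs k)).
- apply: aeW => x; apply/cvgrPdist_le => e e0; near=> k.
  apply: le_trans (proj2 (hs k) x) _; apply: ltW.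
  by near: k; exact: inv0.
- apply/fine_cvgP; split.
    near=> k; rewrite ge0_fin_numE; last exact: integral_ge0.
    apply: le_lt_trans (ltry k.+1%:R^-1); apply: ge0_integral_le_cst => x.
      by rewrite lee_fin.
    by rewrite lee_fin; exact: (proj2 (hs k)).
  apply/cvgrPdist_le => e e0; near=> k; rewrite sub0r normrN /=.
  rewrite ger0_norm; last by apply: fine_ge0; exact: integral_ge0.
  apply: (@le_trans _ _ k.+1%:R^-1); last first.
    by apply: ltW; near: k; exact: inv0.
  rewrite -[leRHS]/(fine (k.+1%:R^-1)%:E); apply: fine_le => //.
    rewrite ge0_fin_numE; last exact: integral_ge0.
    apply: le_lt_trans (ltry k.+1%:R^-1); apply: ge0_integral_le_cst => x.
      by rewrite lee_fin.
    by rewrite lee_fin; exact: (proj2 (hs k)).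
  apply: ge0_integral_le_cst => x; rewrite lee_fin//.
  exact: (proj2 (hs k)).
- exact: cv.
Unshelve. all: by end_near. Qed.

Context (D : R) (d_le : forall x y, d x y <= D).

Lemma lipschitz_bounded (f : X -> R) k : (forall x y, `|f x - f y| <= k * d x y) ->
  forall x, `|f x| <= `|f w0| + `|k| * D.
Proof.
have [d0 _ _ _] := d_metric.
move=> fk x; have -> : f x = f w0 + (f x - f w0) by rewrite addrC subrK.
apply: le_trans (ler_normD _ _) _; rewrite lerD2l; apply: le_trans (fk x w0) _.
apply: (@le_trans _ _ (`|k| * d x w0)); first by rewrite ler_wpM2r// ler_norm.
by rewrite ler_wpM2l.
Qed.

Lemma bochner_integral_linear (nu : probability T R) (l : Y -> R) c :
  (forall a x y, l (a *: x + y) = a * l x + l y) ->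
  (forall x, `|l x| <= c * `|x|) ->
  l (bochner_integral nu (G : T -> Y)) = \int[nu]_x l (G x).
Proof.
have [d0 _ _ _] := d_metric.
move=> ll lc; pose c' := Num.max c 1.
have c0 : 0 < c' by rewrite lt_max ltr01 orbT.
have lc' x : `|l x| <= c' * `|x|.
  by apply: le_trans (lc x) _; rewrite ler_wpM2r// le_max lexx.
have lB x y : l (x - y) = l x - l y.
  by rewrite -scaleN1r addrC ll mulN1r addrC.
have llip x y : `|l (G x) - l (G y)| <= c' * La * d x y.
  by rewrite -lB -mulrA; apply: le_trans (lc' _) _; rewrite ler_pM2l.
apply: (bochner_linear ll c0 lc').
  apply: (bounded_integrable nu (M := `|l (G w0)| + `|c' * La| * D)).
    by apply: measurable_lipschitz; exists (c' * La).
  exact: lipschitz_bounded.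
by apply: xgetPex; exact: bochner_exists.
Qed.

(** [bochner_integral] is a value chosen by [xget]; its inner product with each [z] is the integral
    of [ip (G x) z], and this determines it. *)
Lemma bochner_integral_empirical (n : nat) (n_gt0 : (0 < n)%N) (x : 'I_n -> T) :
  bochner_integral (empirical R x n_gt0) (G : T -> Y) =
  n%:R^-1 *: \sum_(j < n) G (x j).
Proof.
set I := bochner_integral _ _; set S := _ *: _.
have ipc z y : `|ip y z| <= `|z| * `|y|.
  by rewrite mulrC; exact: ip_cauchy_schwarz.
have ipl z a y y' : ip (a *: y + y') z = a * ip y z + ip y' z.
  exact: ip_linear.
have IS z : ip I z = ip S z.
  rewrite (bochner_integral_linear _ (ipl z) (ipc z)).
  have zlip a b : `|ip (G a) z - ip (G b) z| <= `|z| * La * d a b.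
    rewrite -(ipBl ip_inner) -mulrA; apply: le_trans (ipc _ _) _.
    by rewrite ler_wpM2l.
  rewrite (Rintegral_empirical _ _ (M := `|ip (G w0) z| + `|(`|z| * La)| * D)).
  - rewrite /S (ipZl ip_inner); congr (_ * _).
    elim/big_rec2 : _ => [|j a b _ ->]; first by rewrite (ip0l ip_inner).
    by rewrite -[G (x j)]scale1r ipl mul1r scale1r.
  - by apply: measurable_lipschitz; exists (`|z| * La).
  - exact: lipschitz_bounded.
apply/eqP; rewrite -subr_eq0 -normr_le0.
by apply: (ip_norm_le ip_inner) => // z; rewrite (ipBl ip_inner) IS subrr mul0r.
Qed.

End BochnerExistence.

End BorelMetric.

(** * Local slopes *)

Section LocalSlope.
Context {R : realType} {Z : Type} (d : Z -> Z -> R) (F : Z -> R).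
Local Notation slope := (local_slope d (fun z => (F z)%:E)).

Lemma slope_quotE u w :
  (maxe ((F u)%:E - (F w)%:E) 0 * ((d u w)^-1)%:E)%E =
  (Num.max (F u - F w) 0 / d u w)%:E.
Proof. by rewrite -EFinB -EFin_max -EFinM. Qed.

Lemma local_slope_le u a e : 0 < e ->
  (forall w, 0 < d u w < e -> Num.max (F u - F w) 0 / d u w <= a) ->
  (slope u <= a%:E)%E.
Proof.
move=> e0 h; apply: ge_ereal_inf; eexists; first by exists e.
by apply: ge_ereal_sup => _ [w /= we <-]; rewrite slope_quotE lee_fin h.
Qed.

Lemma local_slope_lt u a : (slope u < a%:E)%E ->
  exists2 e, 0 < e & forall w, 0 < d u w < e -> F u - F w <= a * d u w.
Proof.
move=> /ereal_inf_lt[_ [e /= e0 <-] ha]; exists e => // w we.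
have : ((Num.max (F u - F w) 0 / d u w)%:E < a%:E)%E.
  apply: le_lt_trans ha; apply: ereal_sup_ubound.
  by exists w => //; exact: slope_quotE.
have /andP[w0 _] := we.
rewrite lte_fin ltr_pdivrMr// => /ltW; apply: le_trans.
by rewrite le_max lexx.
Qed.

(** Competitors must exist at every scale, since the supremum of the empty set is -oo. *)
Lemma local_slope_ge0 u : (forall e, 0 < e -> exists w, 0 < d u w < e) ->
  (0 <= slope u)%E.
Proof.
move=> h; apply: le_ereal_inf_tmp => _ [e /= e0 <-]; have [w we] := h e e0.
apply: le_ereal_sup_tmp; eexists; first by exists w.
have /andP[w0 _] := we.
by rewrite slope_quotE lee_fin divr_ge0 ?(ltW w0)// le_max lexx orbT.
Qed.

End LocalSlope.

(** [f] preserves the energy and shrinks distances, so it increases positive difference quotients. A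
    [w] that [f] sends to distance 0 from [f u] stops being a competitor, which is why it must not
    have lower energy. *)
Lemma local_slope_le_comparison (R : realType) (Z Z' : Type) (d : Z -> Z -> R)
  (d' : Z' -> Z' -> R) (F : Z -> R) (F' : Z' -> R) (f : Z -> Z') u :
  (forall x y, d' (f x) (f y) <= d x y) -> (forall x y, 0 <= d' (f x) (f y)) ->
  (forall x, F' (f x) = F x) ->
  (forall w, d' (f u) (f w) = 0 -> F u <= F w) ->
  (forall e, 0 < e -> exists w, 0 < d' (f u) w < e) ->
  (local_slope d (fun z => (F z)%:E) u <=
   local_slope d' (fun z => (F' z)%:E) (f u))%E.
Proof.
move=> dd d0 FF eq0 ex; apply: le_ereal_inf_tmp => _ [e /= e0 <-].
apply: ge_ereal_inf; eexists; first by exists e.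
apply: ge_ereal_sup => _ [w /= /andP[w0 we] <-]; rewrite slope_quotE.
have [FuFw|FwFu] := leP (F u) (F w).
  (* The quotient at [w] is 0, which any competitor [v] dominates; [f w] itself may be at distance
     0. *)
  have [v v0] := ex e e0.
  apply: le_ereal_sup_tmp; eexists; first by exists v.
  have /andP[v1 _] := v0.
  rewrite slope_quotE lee_fin (@max_r _ _ (F u - F w)) ?subr_le0// mul0r.
  by rewrite divr_ge0 ?(ltW v1)// le_max lexx orbT.
have d'0 : 0 < d' (f u) (f w).
  rewrite lt_neqAle d0 andbT; apply/eqP => /esym/eq0.
  by rewrite leNgt FwFu.
apply: le_ereal_sup_tmp; eexists.
  by exists (f w) => //=; rewrite d'0 (le_lt_trans (dd _ _)).
rewrite slope_quotE lee_fin !FF ler_wpM2l ?le_max ?lexx ?orbT//.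
by rewrite lef_pV2 ?posrE.
Qed.

(** [l] is the Frechet derivative at [I]. The subgradient inequality compares convexity on the
    segment from [I] to [I + h] with the expansion of [F] at [I + t *: h], divided by [t]. *)
Lemma convex_gradient (R : realType) (Y : normedModType R) (F : Y -> R) (I : Y) :
  convex_real F -> differentiable (F : Y -> R^o) I ->
  exists (l : Y -> R) (c : R),
  [/\ forall a x y, l (a *: x + y) = a * l x + l y,
      forall x, `|l x| <= c * `|x|,
      forall h, l h <= F (I + h) - F I &
      forall e, 0 < e -> exists2 r, 0 < r & forall h, `|h| < r ->
        `|F (I + h) - F I - l h| <= e * `|h| ].
Proof.
move=> Fc Fd; pose l : Y -> R := 'd (F : Y -> R^o) I.
have ll a x y : l (a *: x + y) = a * l x + l y by rewrite /l linearP.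
have lZ a x : l (a *: x) = a * l x by rewrite /l linearZ.
have lc : exists2 c, 0 < c & forall x, `|l x| <= c * `|x|.
  have := (linear_bounded_continuous ('d (F : Y -> R^o) I)).2 (diff_continuous Fd).
  by move=> /linear_boundedP /pinfty_ex_gt0[c c0 h]; exists c.
have lo e : 0 < e -> exists2 r, 0 < r & forall h, `|h| < r ->
    `|F (I + h) - F I - l h| <= e * `|h|.
  move=> e0; have /eqaddoP/(_ e e0) := diff_locally Fd.
  move=> /nbhs_norm0P[r /= r0 hr]; exists r => // h /hr /=.
  by rewrite /cst/= !fctE [h + I]addrC opprD addrA.
have [c c0 cl] := lc.
exists l, c; split=> // h.
apply/ler_addgt0Pl => e e0.
have h1 : 0 < `|h| + 1 by rewrite ltr_wpDl.
have [r r0 hr] := lo _ (divr_gt0 e0 h1).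
(* The summand 1 avoids dividing by a zero norm, and the factor 1/2 makes the bound by [r]
   strict. *)
pose t := Num.min 1 (r / (`|h| + 1) / 2).
have t0 : 0 < t by rewrite lt_min ltr01/= !divr_gt0.
have t1 : t <= 1 by rewrite ge_min lexx.
have th : `|t *: h| < r.
  rewrite normrZ gtr0_norm//.
  apply: (@le_lt_trans _ _ (r / (`|h| + 1) / 2 * (`|h| + 1))).
    apply: ler_pM => //; [exact: ltW|by rewrite ge_min lexx orbT|by rewrite lerDl].
  rewrite mulrAC divfK ?gt_eqF//; lra.
have := hr _ th.

rewrite lZ normrZ (gtr0_norm t0) ler_norml => /andP[lb _].
have : F (I + t *: h) <= t * F (I + h) + (1 - t) * F I.
  have -> : I + t *: h = t *: (I + h) + (1 - t) *: I.
    by rewrite scalerDr scalerBl scale1r [RHS]addrC addrA subrK.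
  by apply: Fc; rewrite ltW.
move: lb; rewrite mulrCA => lb ub.
have : t * l h <= t * (F (I + h) - F I + e).
  have : e / (`|h| + 1) * `|h| <= e.
    rewrite mulrAC ler_pdivrMr// ler_wpM2l//; [exact: ltW|by rewrite lerDl].
  by move=> h2; have := ler_wpM2l (ltW t0) h2; lra.
by rewrite ler_pM2l// addrC.
Qed.

Section Average.
Context {R : realType} (n : nat).
Implicit Types f g : 'I_n -> R.

Definition average f : R := n%:R^-1 * \sum_(j < n) f j.

Lemma average_le f g : (forall j, f j <= g j) -> average f <= average g.
Proof. by move=> fg; rewrite ler_wpM2l// ?invr_ge0//; exact: ler_sum. Qed.

Lemma averageD f g : average (fun j => f j + g j) = average f + average g.
Proof. by rewrite /average big_split mulrDr. Qed.

Lemma averageZ a f : average (fun j => a * f j) = a * average f.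
Proof. by rewrite /average -mulr_sumr mulrCA. Qed.

Lemma averageB f g : average (fun j => f j - g j) = average f - average g.
Proof. by rewrite /average sumrB mulrBr. Qed.

Lemma average_cst a : (0 < n)%N -> average (fun=> a) = a.
Proof.
move=> n0; rewrite /average sumr_const card_ord -(mulr_natl a) mulrA mulVf ?mul1r//.
by rewrite pnatr_eq0 -lt0n.
Qed.

Lemma average_ge0 f : (forall j, 0 <= f j) -> 0 <= average f.
Proof. by move=> f0; rewrite /average mulr_ge0 ?invr_ge0// sumr_ge0. Qed.

(** The variance of [f] is nonnegative. *)
Lemma sqr_average_le f : (0 < n)%N ->
  average f ^+ 2 <= average (fun j => f j ^+ 2).
Proof.
move=> n0; set m := average f.
have : 0 <= average (fun j => (f j ^+ 2 + (- (m + m)) * f j) + m ^+ 2).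
  apply: average_ge0 => j.
  by have := sqr_ge0 (f j - m); rewrite sqrrB; lra.
by rewrite !averageD averageZ average_cst// -/m; lra.
Qed.

End Average.

(** * The slope identity on a totally bounded metric space *)

Section LiftedSlope.
Context {R : realType} {X : Type} (d : X -> X -> R) (w0 : X).
Context (d_metric : is_metric d) (d_tb : totally_bounded_metric d).
Context (D : R) (d_le : forall x y, d x y <= D).
Context {Y : completeNormedModType R} {ip : Y -> Y -> R}.
Context (ip_inner : is_inner_product ip).
Context (F : Y -> R) (F_convex : convex_real F).
Context (F_diff : forall y, differentiable (F : Y -> R^o) y).
Context (G : X -> Y) (s : X -> R) (La : R).
Context (G_lip : forall x y, `|G x - G y| <= La * d x y).
Context (s_lip : forall x y, `|s x - s y| <= La * d x y).
Context (M : R) (M_ge0 : 0 <= M).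
Context (almost_geodesic : forall x y t, 0 < t <= 1 -> exists z,
  [/\ d x z = t * d x y,
      `|G z - G x - t *: (G y - G x)| <= t * (M * d x y ^+ 2) &
      `|s z - s x - t * (s y - s x)| <= t * (M * d x y ^+ 2)]).
Context (s_moves : forall x e, 0 < e -> exists2 y, d x y < e & s y != s x).
Context (n : nat) (n_gt0 : (0 < n)%N).

Local Notation T := (borel d w0).
Local Notation P := (probability T R).
Local Notation W := (W2 (d : T -> T -> R)).

Let d_ge0 x y : 0 <= d x y.
Proof. by have [] := d_metric. Qed.

Let d_sym x y : d x y = d y x.
Proof. by have [] := d_metric. Qed.

Let d_tri x y z : d x z <= d x y + d y z.
Proof. by have [] := d_metric. Qed.

Let d0 x : d x x = 0.
Proof. by have [_ h _ _] := d_metric; exact/h. Qed.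

(** [lifted_energy] for [G] = c^2 K u and [s] = c^2, with a real instead of an extended integral. *)
Definition energy_lift (nu : P) : R :=
  F (bochner_integral nu (G : T -> Y)) + \int[nu]_x s x.

Definition energy_atoms (p : 'I_n -> X) : R :=
  F (n%:R^-1 *: \sum_(j < n) G (p j)) + average (fun j => s (p j)).

Definition dist_atoms (p q : 'I_n -> X) : R :=
  Num.sqrt (average (fun j => d (p j) (q j) ^+ 2)).

Local Notation emp p := (empirical R (p : 'I_n -> T) n_gt0).

Let lip_meas (f : X -> R) k : (forall x y, `|f x - f y| <= k * d x y) ->
  measurable_fun setT (f : T -> R).
Proof. by move=> fk; apply: measurable_lipschitz => //; exists k. Qed.

Let lip_bnd (f : X -> R) k : (forall x y, `|f x - f y| <= k * d x y) ->
  forall x, `|f x| <= `|f w0| + `|k| * D.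
Proof. exact: lipschitz_bounded. Qed.

Let lip_int (nu : P) (f : X -> R) k : (forall x y, `|f x - f y| <= k * d x y) ->
  nu.-integrable setT (EFin \o (f : T -> R)).
Proof.
move=> fk; apply: (bounded_integrable nu (M := `|f w0| + `|k| * D)).
  exact: lip_meas fk.
exact: lip_bnd fk.
Qed.

Let lip_emp (p : 'I_n -> X) (f : X -> R) k :
  (forall x y, `|f x - f y| <= k * d x y) ->
  \int[emp p]_x f x = average (fun j => f (p j)).
Proof.
move=> fk; apply: (Rintegral_empirical _ _ (M := `|f w0| + `|k| * D)).
  exact: lip_meas fk.
exact: lip_bnd fk.
Qed.

Lemma dist_atoms_sqr p q :
  dist_atoms p q ^+ 2 = average (fun j => d (p j) (q j) ^+ 2).
Proof. by rewrite sqr_sqrtr// average_ge0// => j; exact: sqr_ge0. Qed.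

Lemma dist_atoms_ge0 p q : 0 <= dist_atoms p q.
Proof. exact: sqrtr_ge0. Qed.

Lemma energy_lift_empirical p : energy_lift (emp p) = energy_atoms p.
Proof.
rewrite /energy_lift /energy_atoms; congr (F _ + _); last exact: lip_emp s_lip.
exact: (bochner_integral_empirical d_metric d_tb ip_inner G_lip d_le).
Qed.

Lemma W2_empirical_atoms p q : W (emp p) (emp q) <= dist_atoms p q.
Proof. exact: (W2_empirical_le (D := D)). Qed.

(** [W2_duality] handles quadratic costs; the inequality [r <= e + r ^+ 2 / e] trades the linear
    cost for a quadratic one and a constant, which is subtracted from [f]. *)
Lemma Rintegral_lipschitz_le (mu nu : P) (f : X -> R) k e : 0 < k -> 0 < e ->
  (forall x y, `|f x - f y| <= k * d x y) ->
  \int[mu]_x f x - \int[nu]_x f x <= k * e + k / e * W mu nu ^+ 2.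
Proof.
move=> k0 e0 fk.
have fk' x y : `|(f x - k * e) - (f y - k * e)| <= k * d x y.
  by rewrite opprB addrA subrK.
pose B := Num.max (`|f w0| + `|k| * D) (`|f w0 - k * e| + `|k| * D).
have := @W2_duality _ _ T d D d_ge0 d_le mu nu (fun x => f x - k * e) f B (k / e).
move=> /(_ (divr_gt0 k0 e0) (lip_meas fk')).
rewrite (RintegralB (f2 := cst (k * e)))//; last 2 first.
- exact: lip_int fk.
- by apply: (bounded_integrable mu (M := `|k * e|)).
rewrite Rintegral_cst// [X in _ - _ * fine X](probability_setT mu) mulr1.
move=> h; rewrite -lerBlDl addrAC; apply: h.
- by move=> x; rewrite le_max (lip_bnd fk') orbT.
- exact: lip_meas fk.
- by move=> x; rewrite le_max (lip_bnd fk).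
- move=> x y; have /ler_normlW h := fk x y.
  rewrite addrAC lerBlDr; apply: le_trans h _.
  rewrite mulrAC -mulrA -mulrDr ler_pM2l// -lerBlDr ler_pdivlMr//.
  by have := sqr_ge0 (d x y - e); nra.
Qed.

(** Only the first atom moves, so the distance is at most that of the moved atom and the average of
    [s] changes. The change is stated for integrals because those are what [W2] detects. *)
Lemma local_moves p e : 0 < e -> exists q,
  dist_atoms p q < e /\ \int[emp q]_x s x != \int[emp p]_x s x.
Proof.
move=> e0; pose j0 := Ordinal n_gt0.
have [y dy sy] := s_moves (p j0) e0.
pose q j := if j == j0 then y else p j.
have sum1 (h : X -> X -> R) : (forall x, h x x = 0) ->
    \sum_(j < n) h (p j) (q j) = h (p j0) y.
  move=> h0; rewrite (bigD1 j0)//= {1}/q eqxx big1 ?addr0// => j jj0.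
  by rewrite /q (negbTE jj0).
have n1 : 1 <= n%:R :> R by rewrite ler1n.
have n0 : 0 < n%:R :> R by exact: lt_le_trans n1.
exists q; split.
  rewrite -(@ltr_pXn2r _ 2) ?nnegrE ?dist_atoms_ge0 ?(ltW e0)//.
  rewrite dist_atoms_sqr /average (sum1 (fun x y => d x y ^+ 2)); last first.
    by move=> x; rewrite d0 expr0n.
  apply: (@le_lt_trans _ _ (d (p j0) y ^+ 2)).
    by rewrite ler_piMl ?sqr_ge0// invf_le1.
  by rewrite ltr_pXn2r ?nnegrE ?(ltW e0).
rewrite !(lip_emp _ s_lip) -subr_eq0 -averageB /average.
rewrite (sum1 (fun x y => s y - s x)); last by move=> x; rewrite subrr.
by rewrite mulf_eq0 negb_or invr_eq0 gt_eqF//= subr_eq0.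
Qed.

(** Let [e] tend to 0 in [Rintegral_lipschitz_le]. Applied to [f] and to its opposite, this gives
    equal integrals. *)
Lemma Rintegral_lipschitz_W2_eq0 (mu nu : P) (f : X -> R) k :
  (forall x y, `|f x - f y| <= k * d x y) -> W mu nu = 0 ->
  \int[mu]_x f x <= \int[nu]_x f x.
Proof.
move=> fk W0; rewrite -subr_le0; apply/ler_addgt0Pl => e e0; rewrite addr0.
pose k' := Num.max k 1; have k0 : 0 < k' by rewrite lt_max ltr01 orbT.
have fk' x y : `|f x - f y| <= k' * d x y.
  by apply: le_trans (fk x y) _; rewrite ler_wpM2r// le_max lexx.
have := Rintegral_lipschitz_le mu nu k0 (divr_gt0 e0 k0) fk'.
by rewrite W0 expr0n mulr0 addr0 mulrC divfK// gt_eqF.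
Qed.

(** Supplies competitors to both slopes at once: [q] for the atoms, its empirical measure for the
    lifted energy. *)
Lemma W2_moves p e : 0 < e -> exists q, dist_atoms p q < e /\ 0 < W (emp p) (emp q).
Proof.
move=> e0; have [q [pq sq]] := local_moves p e0; exists q; split=> //.
rewrite lt_neqAle W2_ge0 andbT; apply: contra sq => /eqP/esym W0.
have Ns_lip x y : `|- s x - - s y| <= La * d x y by rewrite -opprD normrN.
rewrite eq_le (Rintegral_lipschitz_W2_eq0 s_lip W0) andbT.
have := Rintegral_lipschitz_W2_eq0 Ns_lip W0.
by rewrite !(lip_emp _ Ns_lip) !(lip_emp _ s_lip) /average !sumrN !mulrN lerN2.
Qed.

Section Linearisation.
Context (I : Y) (l : Y -> R) (c : R).
Context (l_linear : forall a x y, l (a *: x + y) = a * l x + l y).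
Context (l_bounded : forall x, `|l x| <= c * `|x|).
Context (l_le : forall h, l h <= F (I + h) - F I).
Context (l_diff : forall e, 0 < e -> exists2 r, 0 < r & forall h, `|h| < r ->
  `|F (I + h) - F I - l h| <= e * `|h|).

Let phi x := l (G x) + s x.

Let lB x y : l (x - y) = l x - l y.
Proof. by rewrite -scaleN1r addrC l_linear mulN1r addrC. Qed.

Let l0 : l 0 = 0.
Proof. by rewrite -(subrr 0) lB subrr. Qed.

Let lZ a x : l (a *: x) = a * l x.
Proof. by rewrite -[a *: x]addr0 l_linear l0 addr0. Qed.

(** The bound on [l] forces [0 <= c] only when [Y] has a nonzero element. *)
Let c' := Num.max c 0.

Let c'0 : 0 <= c'.
Proof. by rewrite le_max lexx orbT. Qed.

Let l_bounded' x : `|l x| <= c' * `|x|.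
Proof. by apply: le_trans (l_bounded x) _; rewrite ler_wpM2r// le_max lexx. Qed.

Let lG_lip x y : `|l (G x) - l (G y)| <= c' * La * d x y.
Proof.
by rewrite -lB -mulrA; apply: le_trans (l_bounded' _) _; rewrite ler_wpM2l.
Qed.

Let phi_lip x y : `|phi x - phi y| <= (c' * La + La) * d x y.
Proof.
rewrite /phi opprD addrACA mulrDl; apply: le_trans (ler_normD _ _) _.
exact: lerD.
Qed.

Let phi_int (nu : P) : \int[nu]_x phi x =
  l (bochner_integral nu (G : T -> Y)) + \int[nu]_x s x.
Proof.
rewrite RintegralD//; [|exact: lip_int lG_lip|exact: lip_int s_lip].
congr (_ + _); apply/esym.
exact: (bochner_integral_linear d_metric d_tb ip_inner G_lip d_le nu l_linear l_bounded).
Qed.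

Lemma energy_lift_diff_le (mu nu : P) : I = bochner_integral mu (G : T -> Y) ->
  energy_lift mu - energy_lift nu <= \int[mu]_x phi x - \int[nu]_x phi x.
Proof.
move=> IE; rewrite !phi_int /energy_lift -IE.
have := l_le (bochner_integral nu (G : T -> Y) - I).
rewrite lB [I + _]addrC subrK; lra.
Qed.

Lemma energy_lift_le_W2_eq0 (mu nu : P) : I = bochner_integral mu (G : T -> Y) ->
  W mu nu = 0 -> energy_lift mu <= energy_lift nu.
Proof.
move=> IE W0; rewrite -subr_le0; apply: le_trans (energy_lift_diff_le _ IE) _.
by rewrite subr_le0; exact: Rintegral_lipschitz_W2_eq0 phi_lip W0.
Qed.

(** Second-order constant of [phi]: [c' * M] from [l \o G] and [M] from [s]. *)
Let Mp := (c' + 1) * M.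

Let phi_geo x y t z : 0 < t <= 1 ->
  `|G z - G x - t *: (G y - G x)| <= t * (M * d x y ^+ 2) ->
  `|s z - s x - t * (s y - s x)| <= t * (M * d x y ^+ 2) ->
  t * (phi x - phi y) - t * (Mp * d x y ^+ 2) <= phi x - phi z.
Proof.
move=> /andP[t0 _] hG hs.
have h1 : l (G z) - l (G x) - t * (l (G y) - l (G x)) <= c' * (t * (M * d x y ^+ 2)).
  rewrite -!lB -lZ -lB; apply: le_trans (ler_norm _) _.
  by apply: le_trans (l_bounded' _) _; rewrite ler_wpM2l.
have h2 := le_trans (ler_norm _) hs.
rewrite /phi /Mp; lra.
Qed.

(** For each [e] one time [t] is small enough for both the slope bound at [p] and the expansion of
    [F] at [I]; the resulting estimate of order [t] scales up to the arbitrary [y]. *)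
Lemma slope_atoms_linearised (p : 'I_n -> X) (S : R) :
  I = n%:R^-1 *: \sum_(j < n) G (p j) ->
  (local_slope dist_atoms (fun q => (energy_atoms q)%:E) p <= S%:E)%E ->
  forall y : 'I_n -> X, average (fun j => phi (p j) - phi (y j)) <=
    S * dist_atoms p y + Mp * dist_atoms p y ^+ 2.
Proof.
move=> IE slopeS y; set r := dist_atoms p y.
have r0 : 0 <= r by exact: dist_atoms_ge0.
apply/ler_addgt0Pl => e e0.
pose La' := Num.max La 1.
have La'0 : 0 < La' by rewrite lt_max ltr01 orbT.
(* With this [a] the total error [a * (1 + La') * r] is [e * (r / (r + 1))], at most [e]; the 1
   comes from the slope and [La'] from the remainder of [F]. *)
have a0 : 0 < e / ((1 + La') * (r + 1)).
  by rewrite divr_gt0// mulr_gt0//; [rewrite addr_gt0|rewrite ltr_wpDl].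
set a := e / _ in a0.
have [d1 d10 hd1] : exists2 e, 0 < e & forall w, 0 < dist_atoms p w < e ->
    energy_atoms p - energy_atoms w <= (S + a) * dist_atoms p w.
  by apply: local_slope_lt; apply: le_lt_trans slopeS _; rewrite lte_fin ltrDl.
have [d2 d20 hd2] := l_diff a0.
(* a point of the geodesics from the [p j] to the [y j], at a small time [t] *)
pose t := Num.min 1 (Num.min d1 (d2 / La') / (r + 1) / 2).
have m0 : 0 < Num.min d1 (d2 / La') by rewrite lt_min d10 divr_gt0.
have r1 : 0 < r + 1 by rewrite ltr_wpDl.
have t0 : 0 < t by rewrite lt_min ltr01/= !divr_gt0.
have t1 : t <= 1 by rewrite ge_min lexx.
have t01 : 0 < t <= 1 by rewrite t0.
(* [d1] keeps [z] in the range of the slope estimate, [d2 / La'] keeps [Iz] in that of the expansion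
   of [F]. *)
have trm : t * r < Num.min d1 (d2 / La').
  apply: (@le_lt_trans _ _ (Num.min d1 (d2 / La') / (r + 1) / 2 * (r + 1))).
    by apply: ler_pM => //; [exact: ltW|rewrite ge_min lexx orbT|rewrite lerDl].
  by rewrite mulrAC divfK ?gt_eqF// ltr_pdivrMr// ltr_pMr// ltr1n.
have /choice[z hz] := fun j => almost_geodesic (p j) (y j) t01.
have pz : dist_atoms p z = t * r.
  apply/eqP; rewrite -(@eqrXn2 _ 2)// ?dist_atoms_ge0 ?mulr_ge0// ?ltW//.
  rewrite exprMn !dist_atoms_sqr -averageZ; apply/eqP; congr average.
  by apply/funext => j; have [-> _ _] := hz j; rewrite exprMn.
pose Iz := n%:R^-1 *: \sum_(j < n) G (z j).
have lavg (q : 'I_n -> X) : l (n%:R^-1 *: \sum_(j < n) G (q j)) =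
    average (fun j => l (G (q j))).
  rewrite lZ /average; congr (_ * _); elim/big_rec2 : _ => // j u v _ <-.
  by rewrite -[G (q j)]scale1r l_linear mul1r scale1r.
have IzI : `|Iz - I| <= La' * (t * r).
  rewrite IE -scalerBr -sumrB normrZ ger0_norm ?invr_ge0//.
  apply: (@le_trans _ _ (average (fun j => La' * d (p j) (z j)))).
    rewrite ler_wpM2l ?invr_ge0//; apply: le_trans (ler_norm_sum _ _ _) _.
    apply: ler_sum => j _; rewrite distrC; apply: le_trans (G_lip _ _) _.
    by rewrite ler_wpM2r// le_max lexx.
  rewrite averageZ ler_pM2l// -pz -(@ler_pXn2r _ 2) ?nnegrE ?dist_atoms_ge0//.
    by rewrite dist_atoms_sqr; exact: sqr_average_le.
  exact: average_ge0.
have phiz : t * average (fun j => phi (p j) - phi (y j)) - t * (Mp * r ^+ 2) <=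
    average (fun j => phi (p j) - phi (z j)).
  rewrite dist_atoms_sqr -!averageZ -averageB; apply: average_le => j.
  by have [_ hG hs] := hz j; exact: phi_geo.
(* The left-hand side is the energy difference plus the remainder of [F] at [I]. *)
have Fz : average (fun j => phi (p j) - phi (z j)) <=
    energy_atoms p - energy_atoms z + a * (La' * (t * r)).
  have : `|Iz - I| < d2.
    apply: le_lt_trans IzI _; rewrite mulrC -ltr_pdivlMr//.
    by apply: lt_le_trans trm _; rewrite ge_min lexx orbT.
  move=> /hd2; rewrite [I + _]addrC subrK => h.
  have {}h := le_trans h (ler_wpM2l (ltW a0) IzI).
  have := ler_norm (F Iz - F I - l (Iz - I)) => h'.
  have {h h'}h := le_trans h' h.
  rewrite averageB !averageD -!lavg -IE /energy_atoms -/Iz -IE.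
  by rewrite lB in h; lra.
(* The slope sees positive distances only; for [r = 0] the two empirical measures are at [W2]
   distance 0. *)
have Jz : energy_atoms p - energy_atoms z <= (S + a) * (t * r).
  have [r00|rn0] := eqVneq r 0; last first.
    rewrite -pz; apply: hd1; rewrite pz mulr_gt0//=; last first.
      by rewrite lt_neqAle eq_sym rn0.
    by apply: lt_le_trans trm _; rewrite ge_min lexx.
  have Wz : W (emp p) (emp z) = 0.
    apply/eqP; rewrite eq_le W2_ge0 andbT.
    by apply: le_trans (W2_empirical_atoms p z) _; rewrite pz r00 mulr0.
  rewrite r00 !mulr0 -!energy_lift_empirical.
  have IE' : I = bochner_integral (emp p) (G : T -> Y).
    by rewrite (bochner_integral_empirical d_metric d_tb ip_inner G_lip d_le).
  by rewrite subr_le0; exact: energy_lift_le_W2_eq0 IE' Wz.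
(* Every term carries the factor [t], which is cancelled next. *)
have : t * average (fun j => phi (p j) - phi (y j)) <=
    t * (S * r + Mp * r ^+ 2 + a * (1 + La') * r) by lra.
rewrite ler_pM2l// => /le_trans; apply.
rewrite addrC lerD2r.
have -> : a * (1 + La') * r = e * (r / (r + 1)).
  by rewrite /a; field; rewrite !gt_eqF// addr_gt0.
by rewrite ler_piMr ?(ltW e0)// ler_pdivrMr// mul1r lerDl.
Qed.

(* [Q] is the infimal convolution of [phi] with [N d^2]; the pair [(Q, phi)] is
   admissible in the dual of the transport problem with cost [N d^2]. The value
   of [N] makes [S r <= S (r ^ 2 / W + W) / 2] absorb the linear term. *)
Lemma energy_lift_descent (p : 'I_n -> X) (S : R) (nu : P) :
  I = n%:R^-1 *: \sum_(j < n) G (p j) -> 0 <= S ->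
  (local_slope dist_atoms (fun q => (energy_atoms q)%:E) p <= S%:E)%E ->
  0 < W (emp p) nu ->
  energy_lift (emp p) - energy_lift nu <=
    S * W (emp p) nu + (Mp + 1) * W (emp p) nu ^+ 2.
Proof.
move=> IE S0 slopeS; set w := W _ _ => w_gt0.
have IE' : I = bochner_integral (emp p) (G : T -> Y).
  by rewrite (bochner_integral_empirical d_metric d_tb ip_inner G_lip d_le).
apply: le_trans (energy_lift_diff_le _ IE') _.
have Mp0 : 0 <= Mp by rewrite mulr_ge0// addr_ge0.
(* The summand 1 keeps [N] positive when [S] and [Mp] vanish. *)
pose N := Mp + 1 + S / (w + w).
have N0 : 0 < N by rewrite ltr_pwDl ?ltr_pwDr// divr_ge0// addr_ge0// ltW.
pose B := `|phi w0| + `|c' * La + La| * D.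
have phiB x : `|phi x| <= B by exact: lip_bnd phi_lip x.
pose E x := [set phi y + N * d x y ^+ 2 | y in setT].
have Elb x : lbound (E x) (- B).
  move=> _ [y _ <-]; have := phiB y; rewrite ler_norml => /andP[? _].
  by rewrite -[- B]addr0 lerD// mulr_ge0// ?sqr_ge0// ltW.
have Einf x : has_inf (E x).
  by split; [exists (phi x + N * d x x ^+ 2); exists x|exists (- B)].
pose Q x := inf (E x).
have Qle x y : Q x <= phi y + N * d x y ^+ 2.
  by apply: (ge_inf (proj2 (Einf x))); exists y.
have Q_le_phi x : Q x <= phi x.
  by apply: le_trans (Qle x x) _; rewrite d0 expr0n mulr0 addr0.
have QB x : `|Q x| <= B.
  rewrite ler_norml; apply/andP; split.
    exact: (lb_le_inf (proj1 (Einf x)) (Elb x)).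
  by apply: le_trans (Q_le_phi x) _; apply: le_trans (ler_norm _) _.
have D0 : 0 <= D by apply: le_trans (d_le w0 w0).
(* The two squared distances to [y] differ by at most [(D + D) * d x x']. Being Lipschitz makes [Q]
   measurable, as the duality demands. *)
have Qlip1 x x' : Q x - Q x' <= N * (D + D) * d x x'.
  rewrite lerBlDl -lerBlDr; apply: (lb_le_inf (proj1 (Einf x'))) => _ [y _ <-].
  rewrite lerBlDr -addrA; apply: le_trans (Qle x y) _; rewrite lerD2l.
  rewrite -mulrA -mulrDr ler_pM2l//.
  have h1 : d x y <= d x x' + d x' y by exact: d_tri.
  have := d_le x y; have := d_le x' y; have := d_ge0 x' y; have := d_ge0 x y.
  have := d_ge0 x x'; nra.
have Qlip x x' : `|Q x - Q x'| <= N * (D + D) * d x x'.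
  rewrite ler_norml Qlip1 andbT lerNl opprB d_sym; exact: Qlip1.
have QS : average (fun j => phi (p j) - Q (p j)) <= S * w / 2.
  apply/ler_addgt0Pl => e e0.
  have /choice[y hy] : forall j, exists y, phi y + N * d (p j) y ^+ 2 < Q (p j) + e.
    move=> j; have [_ [y _ <-] hy] := inf_adherent e0 (Einf (p j)).
    by exists y.
  have := slope_atoms_linearised IE slopeS y.
  set r := dist_atoms p y => h.
  have hj : average (fun j => phi (p j) - Q (p j)) <=
      average (fun j => (phi (p j) - phi (y j) + (- N) * d (p j) (y j) ^+ 2) + e).
    by apply: average_le => j; have := hy j; lra.
  have avgE : average (fun j => (phi (p j) - phi (y j) + (- N) * d (p j) (y j) ^+ 2) + e) =
      average (fun j => phi (p j) - phi (y j)) + (- N) * r ^+ 2 + e.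
    by rewrite /r dist_atoms_sqr -[X in _ = _ + X](average_cst e n_gt0) -averageZ -!averageD.
  apply: le_trans hj _; rewrite avgE [leRHS]addrC lerD2r.
  apply: (@le_trans _ _ (S * r + Mp * r ^+ 2 + - N * r ^+ 2)).
    by rewrite lerD2r.
  (* Completing the square in [r - w] leaves [S * w / 2] minus two nonnegative terms. *)
  have -> : S * r + Mp * r ^+ 2 + - N * r ^+ 2 =
      S * w / 2 - S * (r - w) ^+ 2 / (w + w) - r ^+ 2.
    by rewrite /N; field; rewrite gt_eqF// addr_gt0.
  rewrite -addrA gerDl -opprD oppr_le0 addr_ge0 ?sqr_ge0//.
  by apply: divr_ge0; [exact: mulr_ge0 S0 (sqr_ge0 _)|rewrite addr_ge0 ?(ltW w_gt0)].
have dual : \int[emp p]_x Q x - \int[nu]_x phi x <= N * w ^+ 2.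
  apply: (@W2_duality _ _ T d D d_ge0 d_le _ _ Q phi B) => //.
  - exact: lip_meas Qlip.
  - exact: lip_meas phi_lip.
  - by move=> x y; rewrite lerBlDl.
rewrite (lip_emp p phi_lip); rewrite (lip_emp p Qlip) in dual.
rewrite averageB in QS.
(* The other half of [S * w] is contained in [N * w ^+ 2]. *)
have -> : S * w + (Mp + 1) * w ^+ 2 = N * w ^+ 2 + S * w / 2.
  by rewrite /N; field; rewrite gt_eqF// addr_gt0.
by lra.
Qed.

End Linearisation.

Theorem local_slope_empirical (p : 'I_n -> X) :
  local_slope W (fun nu => (energy_lift nu)%:E) (emp p) =
  local_slope dist_atoms (fun q => (energy_atoms q)%:E) p.
Proof.
pose I := n%:R^-1 *: \sum_(j < n) G (p j).
have IE' : I = bochner_integral (emp p) (G : T -> Y).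
  by rewrite (bochner_integral_empirical d_metric d_tb ip_inner G_lip d_le).
have [l [c [ll lc lle ldiff]]] := convex_gradient F_convex (F_diff I).
apply/eqP; rewrite eq_le; apply/andP; split; last first.
  apply: (@local_slope_le_comparison _ _ _ dist_atoms W energy_atoms
      energy_lift (fun p => emp p)).
  - exact: W2_empirical_atoms.
  - by move=> x y; exact: W2_ge0.
  - exact: energy_lift_empirical.
  - move=> q W0; rewrite -!energy_lift_empirical.
    exact: (energy_lift_le_W2_eq0 ll lc lle IE' W0).
  - move=> e e0; have [q [pq q0]] := W2_moves p e0.
    by exists (emp q); rewrite q0 (le_lt_trans (W2_empirical_atoms _ _)).
set sl := local_slope dist_atoms _ _.
have sl0 : (0 <= sl)%E.
  apply: local_slope_ge0 => e e0; have [q [pq q0]] := W2_moves p e0.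
  by exists q; rewrite pq (lt_le_trans q0)// W2_empirical_atoms.
(* An infinite slope bounds everything, and [sl0] excludes -oo. *)
case slE : sl sl0 => [S| |]// S0; last by rewrite leey.
have slS : (sl <= S%:E)%E by rewrite slE.
apply/lee_addgt0Pr => e e0; rewrite -EFinD.
rewrite lee_fin in S0.
set Mp := (Num.max c 0 + 1) * M + 1.
have Mp0 : 0 < Mp.
  by rewrite ltr_wpDl// mulr_ge0// addr_ge0// le_max lexx orbT.
(* Within this radius the quadratic term of [energy_lift_descent] is at most [e] times the
   distance. *)
apply: (@local_slope_le _ _ _ _ _ _ (e / Mp)); first exact: divr_gt0.
move=> nu /andP[W0 We]; rewrite ler_pdivrMr// ge_max.
rewrite [X in _ && X]mulr_ge0 ?andbT ?(ltW W0) ?addr_ge0 ?(ltW e0)//.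
apply: le_trans (energy_lift_descent ll lc lle ldiff _ _ slS W0) _ => //.
rewrite -/Mp [leRHS]mulrDl lerD2l expr2 mulrA ler_pM2r// mulrC -ler_pdivlMr//.
exact: ltW.
Qed.

End LiftedSlope.

(** * Weakly differentiable curves *)

Section UnitIntervalDerivative.
Context {R : realType}.
Implicit Types (f df : R -> R) (t l : R).

Lemma derivative_within01P f t l : derivative_within01 f t l ->
  forall e, 0 < e -> exists2 r, 0 < r & forall x, 0 <= x <= 1 -> `|x - t| < r ->
    `|f x - f t - l * (x - t)| <= e * `|x - t|.
Proof.
move=> /cvgrPdist_le fl e e0; have := fl e e0; rewrite !near_withinE.
move=> /nbhs_ballP[r /= r0 hr]; exists r => // x x01 xt.
have [->|xneq] := eqVneq x t; first by rewrite !subrr mulr0 subrr normr0 mulr0.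
have xt0 : x - t != 0 by rewrite subr_eq0.
have tx : ball t r x by rewrite -ball_normE /= distrC.
have := hr x tx xneq; rewrite in_itv/= => /(_ x01) h.
have -> : f x - f t - l * (x - t) = - ((l - (f x - f t) / (x - t)) * (x - t)).
  by field.
by rewrite normrN normrM ler_wpM2r.
Qed.

(** Strictly between [a] and [b] small increments of both signs stay in the unit interval, so the
    derivative is two-sided there; at [a] and [b] only continuity is required, which the one-sided
    derivative gives. *)
Lemma mean_value01 f df : (forall t, 0 <= t <= 1 -> derivative_within01 f t (df t)) ->
  forall a b, 0 <= a -> a < b -> b <= 1 ->
  exists2 x, a < x < b & f b - f a = df x * (b - a).
Proof.
move=> fdf a b a0 ab b1.
have [x] : exists2 x, x \in `]a, b[%R & f b - f a = df x * (b - a); last first.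
  by rewrite in_itv/= => xab xE; exists x.
apply: MVT => //.
  move=> x; rewrite in_itv/= => /andP[ax xb].
  have x01 : 0 <= x <= 1 by apply/andP; split; lra.
  have h := derivative_within01P (fdf x x01).
  have cv : (h0^-1 *: (f (h0 *: (1 : R) + x) - f x)) @[h0 --> 0^'] --> df x.
    apply/cvgrPdist_le => e e0; have [r r0 hr] := h e e0.
    near=> k; have k0 : k != 0 by near: k; exact: nbhs_dnbhs_neq.
    have kr : `|k| < r by near: k; exact: dnbhs0_lt.
    have ka : `|k| < x - a by near: k; apply: dnbhs0_lt; rewrite subr_gt0.
    have kb : `|k| < b - x by near: k; apply: dnbhs0_lt; rewrite subr_gt0.
    have := hr (k *: (1 : R) + x); rewrite /GRing.scale/= mulr1 addrK => /(_ _ kr).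
    move: ka kb; rewrite !ltr_norml => /andP[ka _] /andP[_ kb].
    have -> : 0 <= k + x <= 1 by apply/andP; split; lra.
    move=> /(_ isT) hh.
    have -> : df x - k^-1 * (f (k + x) - f x) =
      - ((f (k + x) - f x - df x * k) / k) by field.
    by rewrite normrN normrM normfV ler_pdivrMr ?normr_gt0.
  apply: DeriveDef; first by apply/cvg_ex; exists (df x).
  exact: cvg_lim cv.
apply/subspace_continuousP => x /=; rewrite in_itv/= => /andP[ax xb].
have x01 : 0 <= x <= 1 by apply/andP; split; lra.
have [r r0 hr] := derivative_within01P (fdf x x01) ltr01.
apply/cvgrPdist_le => e e0; rewrite near_withinE.
have df1 : 0 < 1 + `|df x| by rewrite ltr_pwDl.
near=> y; rewrite /= in_itv/= => /andP[ay yb].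
have y01 : 0 <= y <= 1 by apply/andP; split; lra.
have yr : `|y - x| < r by rewrite distrC; near: y; exact: cvgr_dist_lt.
have ye : `|y - x| < e / (1 + `|df x|).
  by rewrite distrC; near: y; apply: cvgr_dist_lt => //; exact: divr_gt0.
have h := hr y y01 yr.
rewrite distrC; have -> : f y - f x = (f y - f x - df x * (y - x)) + df x * (y - x).
  by rewrite subrK.
apply: le_trans (ler_normD _ _) _; rewrite normrM.
apply: (@le_trans _ _ (1 * `|y - x| + `|df x| * `|y - x|)); first by rewrite lerD2r.
by rewrite -mulrDl mulrC -ler_pdivlMr// ltW.
Unshelve. all: by end_near. Qed.

(** The two increments are [t * df x] and [df y] for some [x] and [y], and a third mean value
    compares [df x] with [df y]. The factor [t] survives, as [almost_geodesic] needs. *)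
Lemma second_order01 f df ddf m t :
  (forall t, 0 <= t <= 1 -> derivative_within01 f t (df t)) ->
  (forall t, 0 <= t <= 1 -> derivative_within01 df t (ddf t)) ->
  (forall t, 0 <= t <= 1 -> `|ddf t| <= m) -> 0 < t <= 1 ->
  `|f t - f 0 - t * (f 1 - f 0)| <= t * m.
Proof.
move=> h1 h2 hm /andP[t0 t1].
have [x /andP[x0 xt]] := mean_value01 h1 (lexx 0) t0 t1.
have [y /andP[y0 y1]] := mean_value01 h1 (lexx 0) ltr01 (lexx 1).
rewrite !subr0 => -> ->; rewrite mulr1 mulrC -mulrBr normrM gtr0_norm//.
rewrite ler_pM2l//.
have key a b : 0 <= a -> a < b -> b <= 1 -> `|df b - df a| <= m.
  move=> a0 ab b1; have [z /andP[az zb] ->] := mean_value01 h2 a0 ab b1.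
  have z01 : 0 <= z <= 1 by apply/andP; split; lra.
  have ba : `|b - a| <= 1 by rewrite ger0_norm; lra.
  by rewrite normrM -[leRHS]mulr1; apply: ler_pM => //; exact: hm.
have [xy|yx|->] := ltgtP x y.
- by rewrite distrC; apply: key => //; exact: ltW.
- by apply: key; [exact: ltW| |lra].
- by rewrite subrr normr0; apply: le_trans (hm 0 _) => //; rewrite lexx ler01.
Qed.

End UnitIntervalDerivative.

Section Geodesics.
Context {R : realType} {Y : normedModType R} {ip : Y -> Y -> R}.
Context (ip_inner : is_inner_product ip).
Context (k D1 D2 : R -> Y) (m1 m2 : R).
Context (kD1 : weak_derivative01 ip k D1) (kD2 : weak_derivative01 ip D1 D2).
Context (D1_le : forall t, 0 <= t <= 1 -> `|D1 t| <= m1).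
Context (D2_le : forall t, 0 <= t <= 1 -> `|D2 t| <= m2).

Lemma weak_curve_lipschitz : `|k 1 - k 0| <= m1.
Proof.
have m0 : 0 <= m1 by apply: le_trans (D1_le (t := 0) _); rewrite ?lexx ?ler01.
apply: (ip_norm_le ip_inner) => // z.
have [x /andP[x0 x1] h] := mean_value01 (@kD1 z) (lexx 0) ltr01 (lexx 1).
rewrite (ipBl ip_inner) h subr0 mulr1.
apply: le_trans (ler_norm _) _; apply: le_trans (ip_cauchy_schwarz ip_inner _ _) _.
by rewrite ler_wpM2r// D1_le// !ltW.
Qed.

(** Each [z] gives a scalar function to which [second_order01] applies, with a bound proportional to
    the norm of [z]. *)
Lemma weak_curve_second_order t : 0 < t <= 1 ->
  `|k t - k 0 - t *: (k 1 - k 0)| <= t * m2.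
Proof.
move=> t01; have /andP[t0 t1] := t01.
have m0 : 0 <= m2 by apply: le_trans (D2_le (t := 0) _); rewrite ?lexx ?ler01.
apply: (ip_norm_le ip_inner) => [|z]; first by rewrite mulr_ge0// ltW.
rewrite !(ipBl ip_inner) (ipZl ip_inner) (ipBl ip_inner) -mulrA.
apply: le_trans (ler_norm _) _.
apply: (second_order01 (@kD1 z) (@kD2 z)) => // x x01.
apply: le_trans (ip_cauchy_schwarz ip_inner _ _) _.
by rewrite ler_wpM2r// D2_le.
Qed.

End Geodesics.

(** * The space Omega *)

(** The relation lives on the subtype but compactness on the ambient space, hence the open sets [V]
    of [Z]. *)
Lemma compact_finite_net (Z : ptopologicalType) (A : set Z) (r : A -> A -> bool) :
  compact A ->
  (forall x : A, exists V : set Z,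
    [/\ open V, V (val x) & forall y : A, V (val y) -> r x y]) ->
  exists l : seq A, forall y, has (fun x => r x y) l.
Proof.
move=> cA /choice[V hV].
have := cA; rewrite compact_cover => /(_ _ setT V)[].
- by move=> x _; have [] := hV x.
- move=> z Az; exists (SigSub (mem_set Az : z \in A)) => //.
  by have [] := hV (SigSub (mem_set Az : z \in A)).
- move=> D _ AD; exists (enum_fset D) => y.
  have [x /= xD Vxy] := AD (val y) (set_mem (valP y)).
  by apply/hasP; exists x => //; have [_ _] := hV x; apply.
Qed.

Section Pythagoras.
Context {R : realType}.
Implicit Types a b : R.

Lemma le_sqrt_sum_sqr1 a b : `|a| <= Num.sqrt (a ^+ 2 + b ^+ 2).
Proof. by rewrite -sqrtr_sqr ler_wsqrtr// lerDl sqr_ge0. Qed.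

Lemma le_sqrt_sum_sqr2 a b : `|b| <= Num.sqrt (a ^+ 2 + b ^+ 2).
Proof. by rewrite -sqrtr_sqr ler_wsqrtr// lerDr sqr_ge0. Qed.

Lemma sqrt_sum_sqr_le a b : 0 <= a -> 0 <= b ->
  Num.sqrt (a ^+ 2 + b ^+ 2) <= a + b.
Proof.
move=> a0 b0; rewrite -(@ler_pXn2r _ 2) ?nnegrE ?sqrtr_ge0 ?addr_ge0//.
by rewrite sqr_sqrtr ?addr_ge0 ?sqr_ge0//; nra.
Qed.

Lemma sqrt_sum_sqr_triangle a1 a2 b1 b2 :
  Num.sqrt ((a1 + a2) ^+ 2 + (b1 + b2) ^+ 2) <=
  Num.sqrt (a1 ^+ 2 + b1 ^+ 2) + Num.sqrt (a2 ^+ 2 + b2 ^+ 2).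
Proof.
have e1 : Num.sqrt (a1 ^+ 2 + b1 ^+ 2) ^+ 2 = a1 ^+ 2 + b1 ^+ 2.
  by rewrite sqr_sqrtr// addr_ge0// sqr_ge0.
have e2 : Num.sqrt (a2 ^+ 2 + b2 ^+ 2) ^+ 2 = a2 ^+ 2 + b2 ^+ 2.
  by rewrite sqr_sqrtr// addr_ge0// sqr_ge0.
rewrite -(@ler_pXn2r _ 2) ?nnegrE ?sqrtr_ge0 ?addr_ge0 ?sqrtr_ge0//.
rewrite sqr_sqrtr ?addr_ge0 ?sqr_ge0//.
set r1 := Num.sqrt _ in e1 *; set r2 := Num.sqrt _ in e2 *.
have r10 : 0 <= r1 by exact: sqrtr_ge0.
have r20 : 0 <= r2 by exact: sqrtr_ge0.
have : a1 * a2 + b1 * b2 <= r1 * r2.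
  apply: le_trans (ler_norm _) _.
  rewrite -(@ler_pXn2r _ 2) ?nnegrE ?mulr_ge0// real_normK ?num_real//.
  rewrite exprMn e1 e2; have := sqr_ge0 (a1 * b2 - a2 * b1); nra.
by rewrite !sqrrD e1 e2; nra.
Qed.

End Pythagoras.

Lemma totally_bounded_bounded (R : realType) (X : Type) (d : X -> X -> R) :
  is_metric d -> totally_bounded_metric d ->
  exists D, forall x y, d x y <= D.
Proof.
move=> [d0 _ dC dtri] tb; have [l hl] := tb 1 ltr01.
have [w|X0] := pselect (inhabited X); last first.
  by exists 0 => x; exfalso; apply: X0.
case: w => w.
have dN x : d x w <= 1 + \sum_(v <- l) d v w.
  have := hl x; elim: {hl}l => // v l ih.
  have l0 : 0 <= \sum_(j <- l) d j w by exact: sumr_ge0.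
  rewrite big_cons /= => /orP[xv|/ih h].
    by have := dtri x v w; lra.
  by have := d0 v w; lra.
set N := 1 + _ in dN; exists (N + N) => x y; apply: le_trans (dtri x w y) _.
by rewrite (dC w y) lerD.
Qed.

(** Used to pass from pairs of families, as in [Omega_n], to families of pairs, as in
    [dist_atoms]. *)
Lemma local_slope_transfer (R : realType) (Z Z' : Type) (d : Z -> Z -> R)
  (d' : Z' -> Z' -> R) (F : Z -> \bar R) (F' : Z' -> \bar R) (f : Z -> Z') u :
  (forall x y, d x y = d' (f x) (f y)) -> (forall x, F x = F' (f x)) ->
  (forall x', exists x, f x = x') -> local_slope d F u = local_slope d' F' (f u).
Proof.
move=> dE FE fsurj; rewrite /local_slope.
congr (ereal_inf (_ @` _)); apply/funext => e; congr ereal_sup.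
apply/seteqP; split => [_ [w /= we <-]|_ [w' /= we <-]].
  by exists (f w); [rewrite /= -dE|rewrite !FE dE].
have [w wE] := fsurj w'; rewrite -wE in we *.
by exists w; [rewrite /= dE|rewrite !FE dE].
Qed.

Section Omega.
Context {R : realType} {C : normedModType R} {Y : completeNormedModType R}.
Context {ip : Y -> Y -> R} (ip_inner : is_inner_product ip).
Context (K : {linear dual C -> Y}) (B : set (dual C)) (dB : B -> B -> R).
Context (B_compact : compact B) (dB_metrizes : metrizes dB).
Context (dB_geodesic : geodesically_complete dB).
Context (K_geodesic : geodesic_derivative_bound K dB ip).
Context (L : R) (L_gt0 : 0 < L).

Local Notation dO := (@d_Omega R C L B dB).

Let dBm : is_metric dB.
Proof. by case: dB_metrizes. Qed.

Let dB_ge0 u v : 0 <= dB u v.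
Proof. by have [] := dBm. Qed.

Lemma totally_bounded_dB : totally_bounded_metric dB.
Proof.
move=> e e0; have [_ _ dC _] := dBm.
apply: (@compact_finite_net _ B (fun v x => dB x v < e)) => // v.
have : nbhs v [set y | dB v y < e].
  by have [_ ->] := dB_metrizes; exists e.
rewrite nbhsE => -[U [[V oV VU] Uv] Ue].
exists V; split=> //; first by move: Uv; rewrite -VU.
by move=> y Vy; rewrite dC; apply: Ue; rewrite -VU.
Qed.

Lemma d_Omega_metric : is_metric dO.
Proof.
have [b0 b1 b2 b3] := dBm; split.
- by move=> x y; exact: sqrtr_ge0.
- move=> [a u] [b v]; rewrite /d_Omega/=; split.
    move=> h; have := le_sqrt_sum_sqr1 (`|val a - val b|) (dB u v).
    have := le_sqrt_sum_sqr2 (`|val a - val b|) (dB u v).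
    rewrite h !normr_le0 normr_eq0 subr_eq0 => /eqP/b1 -> /eqP ab.
    by congr (_, _); exact: val_inj.
  by move=> [-> ->]; rewrite subrr normr0 (b1 v v).2// expr0n addr0 sqrtr0.
- by move=> x y; rewrite /d_Omega distrC b2.
- move=> x y z; apply: le_trans (sqrt_sum_sqr_triangle _ _ _ _).
  rewrite ler_wsqrtr// lerD//.
    rewrite ler_pXn2r ?nnegrE ?addr_ge0//.
    by have := ler_normD (val x.1 - val y.1) (val y.1 - val z.1); rewrite addrA subrK.
  by rewrite ler_pXn2r ?nnegrE ?addr_ge0.
Qed.

Lemma totally_bounded_itv e : 0 < e -> exists s : seq `[0, L]%classic,
  forall x : `[0, L]%classic, has (fun v => `|val x - val v| < e) s.
Proof.
move=> e0.
apply: (@compact_finite_net _ _ (fun v x => `|val x - val v| < e)).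
  exact: segment_compact.
move=> x; exists (ball (val x) e); split; [exact: ball_open|exact: ballxx|].
by move=> y; rewrite -ball_normE /= distrC.
Qed.

Lemma totally_bounded_d_Omega : totally_bounded_metric dO.
Proof.
move=> e e0; have e2 : 0 < e / 2 by rewrite divr_gt0.
have [s1 h1] := totally_bounded_itv e2; have [s2 h2] := totally_bounded_dB e2.
exists [seq (a, u) | a <- s1, u <- s2] => -[a u].
have /hasP[a' a's aa'] := h1 a; have /hasP[u' u's uu'] := h2 u.
apply/hasP; exists (a', u'); first exact: allpairs_f.
apply: le_lt_trans (sqrt_sum_sqr_le _ _) _ => //=.
by rewrite [ltRHS]splitr ltrD.
Qed.

(** Condenses (A8): the first derivative gives the Lipschitz bound, the second the deviation from
    affinity at [w = g t]. *)
Lemma K_along_geodesics : exists2 c, 0 < c & forall u v : B,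
  `|K (val v) - K (val u)| <= c * dB u v /\
  forall t, 0 < t <= 1 -> exists2 w : B, dB u w = t * dB u v &
    `|K (val w) - K (val u) - t *: (K (val v) - K (val u))| <=
      t * (c * dB u v ^+ 2).
Proof.
have [c c0 hc] := K_geodesic; exists c => // u v.
have [g [gg g0 g1]] := dB_geodesic u v.
have [D1 [D2 [kD1 kD2 D12]]] := hc g gg.
rewrite g0 g1 in D12.
have D1_le t : 0 <= t <= 1 -> `|D1 t| <= c * dB u v by move=> /D12[].
have D2_le t : 0 <= t <= 1 -> `|D2 t| <= c * dB u v ^+ 2 by move=> /D12[].
split; first by have := weak_curve_lipschitz ip_inner kD1 D1_le; rewrite g0 g1.
move=> t t01; exists (g t); last first.
  by have := weak_curve_second_order ip_inner kD1 kD2 D2_le t01; rewrite g0 g1.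
have /andP[t0 t1] := t01.
by rewrite -{1}g0 gg ?lexx ?ler01 ?(ltW t0)// sub0r normrN gtr0_norm// g0 g1.
Qed.

(** The estimate for c^2 K u after testing: [K0], [K1], [Kt] stand for inner products with an
    element of norm [z], and [m] for a bound on [K]. An upper bound is all that [ip_norm_le] asks
    for. *)
Lemma sqr_scaled_second_order (c0 c1 t K0 K1 Kt b z m c : R) :
  0 <= c0 <= L -> 0 <= c1 <= L -> 0 < t <= 1 -> 0 <= b -> 0 <= z -> 0 <= m ->
  0 <= c -> `|Kt - K0 - t * (K1 - K0)| <= t * (c * b ^+ 2) * z ->
  `|K0| <= m * z -> `|K1| <= m * z -> `|K1 - K0| <= c * b * z ->
  ((1 - t) * c0 + t * c1) ^+ 2 * Kt - c0 ^+ 2 * K0 -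
    t * (c1 ^+ 2 * K1 - c0 ^+ 2 * K0) <=
  t * ((L ^+ 2 * c + m + L * c) * (`|c0 - c1| ^+ 2 + b ^+ 2)) * z.
Proof.
move=> /andP[c00 c0L] /andP[c10 c1L] /andP[t0 t1] b0 z0 m0 c_ge0 hr h0 h1 h01.
set r := Kt - K0 - t * (K1 - K0) in hr.
set e := `|c0 - c1|; have e0 : 0 <= e by exact: normr_ge0.
set at_ := ((1 - t) * c0 + t * c1) ^+ 2.
have eE : e ^+ 2 = (c1 - c0) ^+ 2 by rewrite /e distrC real_normK ?num_real.
(* Three sources of error: the deviation of [K] from affinity, the curvature of the square, and the
   covariance of the two interpolations. *)
have -> : at_ * Kt - c0 ^+ 2 * K0 - t * (c1 ^+ 2 * K1 - c0 ^+ 2 * K0) =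
  at_ * r - t * (1 - t) * (e ^+ 2 * ((1 - t) * K0 + t * K1)) -
  t * (1 - t) * ((c1 + c0) * (c1 - c0) * (K1 - K0)).
  by rewrite eE /at_ /r; ring.
have t1' : 0 <= 1 - t by rewrite subr_ge0.
have s0 : 0 <= (1 - t) * c0 + t * c1 by rewrite addr_ge0// mulr_ge0// ltW.
have sL : (1 - t) * c0 + t * c1 <= L.
  by have := ler_wpM2l t1' c0L; have := ler_wpM2l (ltW t0) c1L; lra.
have A1 : at_ * r <= t * (L ^+ 2 * c * b ^+ 2 * z).
  have -> : t * (L ^+ 2 * c * b ^+ 2 * z) = L ^+ 2 * (t * (c * b ^+ 2) * z) by ring.
  apply: le_trans (ler_norm _) _; rewrite normrM; apply: ler_pM => //.
  by rewrite ger0_norm ?sqr_ge0// /at_ ler_pXn2r ?nnegrE// ltW.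
have A2 : - (e ^+ 2 * ((1 - t) * K0 + t * K1)) <= e ^+ 2 * (m * z).
  rewrite -mulrN ler_wpM2l ?sqr_ge0//.
  move: h0 h1; rewrite !ler_norml => /andP[h0 _] /andP[h1 _]; nra.
have A3 : - ((c1 + c0) * (c1 - c0) * (K1 - K0)) <= L * c * (e ^+ 2 + b ^+ 2) * z.
  apply: (@le_trans _ _ ((L + L) * e * (c * b * z))).
    apply: le_trans (ler_norm _) _; rewrite normrN !normrM.
    apply: ler_pM => //.
    apply: ler_pM => //; last by rewrite /e distrC.
    by rewrite ger0_norm ?addr_ge0// lerD.
  have -> : (L + L) * e * (c * b * z) = L * c * (e * b + e * b) * z by ring.
  rewrite ler_wpM2r// ler_wpM2l//; last by have := sqr_ge0 (e - b); nra.
  by rewrite mulr_ge0// ltW.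
have B2 : 0 <= e ^+ 2 * (m * z) by rewrite !mulr_ge0// sqr_ge0.
have B3 : 0 <= L * c * (e ^+ 2 + b ^+ 2) * z.
  by rewrite !mulr_ge0// ?(ltW L_gt0)// addr_ge0 ?sqr_ge0.
have tt : 0 <= t * (1 - t) by rewrite mulr_ge0// ltW.
have tt1 : t * (1 - t) <= t by rewrite ger_pMr// lerBlDr lerDl ltW.
have A2' := ler_wpM2l tt A2.
have A3' := ler_wpM2l tt A3.
have A2'' := ler_wpM2r B2 tt1.
have A3'' := ler_wpM2r B3 tt1.
(* Two nonnegative terms complete the bounds from [A1] and [A2] to the common factor
   [e ^+ 2 + b ^+ 2]. *)
have : 0 <= t * ((L ^+ 2 * c) * e ^+ 2 * z).
  apply: mulr_ge0 (ltW t0) (mulr_ge0 _ z0).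
  by apply: mulr_ge0 (sqr_ge0 _); apply: mulr_ge0 (sqr_ge0 _) _.
have : 0 <= t * (m * b ^+ 2 * z).
  exact: mulr_ge0 (ltW t0) (mulr_ge0 (mulr_ge0 m0 (sqr_ge0 _)) z0).
lra.
Qed.

Local Notation massO := (fun w : Omega L B => val w.1 ^+ 2).
Local Notation fieldO := (fun w : Omega L B => val w.1 ^+ 2 *: K (val w.2)).

Lemma itv_val_bounds (a : `[0, L]%classic) : 0 <= val a <= L.
Proof. by have := set_mem (valP a); rewrite /= in_itv. Qed.

Lemma itv_of_bounds a : 0 <= a <= L -> exists x : `[0, L]%classic, val x = a.
Proof.
move=> h; have m : a \in `[0, L]%classic by apply/mem_set; rewrite /= in_itv.
by exists (SigSub m).
Qed.

Lemma K_bounded (u0 : B) : exists2 m, 0 <= m & forall u : B, `|K (val u)| <= m.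
Proof.
have [c c0 hc] := K_along_geodesics.
have [D hD] := totally_bounded_bounded dBm totally_bounded_dB.
have D0 : 0 <= D by exact: le_trans (hD u0 u0).
exists (`|K (val u0)| + c * D); first by rewrite addr_ge0// mulr_ge0// ltW.
move=> u; have [h _] := hc u0 u.
rewrite -[K (val u)](subrK (K (val u0))) addrC.
apply: le_trans (ler_normD _ _) _; rewrite lerD2l; apply: le_trans h _.
by rewrite ler_pM2l.
Qed.

Lemma Omega_lipschitz (u0 : B) : exists La, forall x y : Omega L B,
  `|fieldO x - fieldO y| <= La * dO x y /\ `|massO x - massO y| <= La * dO x y.
Proof.
have [m m0 hm] := K_bounded u0; have [c c0 hc] := K_along_geodesics.
exists ((L + L) * m + L ^+ 2 * c + (L + L)) => -[a u] [b v] /=.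
have d1 : `|val a - val b| <= dO (a, u) (b, v).
  by have := le_sqrt_sum_sqr1 (`|val a - val b|) (dB u v); rewrite normr_id.
have d2 : dB u v <= dO (a, u) (b, v).
  by have := le_sqrt_sum_sqr2 (`|val a - val b|) (dB u v); rewrite ger0_norm.
set D := dO _ _ in d1 d2 *.
have /andP[a0 aL] := itv_val_bounds a; have /andP[b0 bL] := itv_val_bounds b.
have L0 := ltW L_gt0.
have D0 : 0 <= D by exact: le_trans d2.
have hs : `|val a ^+ 2 - val b ^+ 2| <= (L + L) * D.
  rewrite subr_sqr mulrC normrM; apply: ler_pM => //.
  by rewrite ger0_norm ?addr_ge0// lerD.
have L2c : 0 <= L ^+ 2 * c by rewrite mulr_ge0 ?sqr_ge0// ltW.
split; last first.
  apply: le_trans hs _; rewrite ler_wpM2r// lerDr addr_ge0// mulr_ge0//.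
  exact: addr_ge0.
have -> : val a ^+ 2 *: K (val u) - val b ^+ 2 *: K (val v) =
    (val a ^+ 2 - val b ^+ 2) *: K (val u) + val b ^+ 2 *: (K (val u) - K (val v)).
  by rewrite scalerBl scalerBr addrA subrK.
apply: le_trans (ler_normD _ _) _; rewrite !normrZ.
apply: (@le_trans _ _ ((L + L) * D * m + L ^+ 2 * (c * D))).
  apply: lerD; apply: ler_pM => //.
    by rewrite -expr2 ler_pXn2r ?nnegrE// ger0_norm.
  have [_ _ dC _] := dBm.
  by have [h _] := hc v u; apply: le_trans h _; rewrite ler_pM2l// dC.
have : 0 <= (L + L) * D by rewrite mulr_ge0// addr_ge0.
lra.
Qed.

(** [z] interpolates the mass coordinate affinely and follows a geodesic of [B], so it lies on a
    geodesic of the product metric. *)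
Lemma Omega_almost_geodesic (u0 : B) : exists2 M, 0 <= M &
  forall (x y : Omega L B) t, 0 < t <= 1 -> exists z,
  [/\ dO x z = t * dO x y,
      `|fieldO z - fieldO x - t *: (fieldO y - fieldO x)| <= t * (M * dO x y ^+ 2) &
      `|massO z - massO x - t * (massO y - massO x)| <= t * (M * dO x y ^+ 2)].
Proof.
have [m m0 hm] := K_bounded u0; have [c c0 hc] := K_along_geodesics.
have L0 := ltW L_gt0.
pose M := L ^+ 2 * c + m + L * c.
have M0 : 0 <= M.
  by rewrite /M !addr_ge0// mulr_ge0 ?sqr_ge0// ltW.
(* The extra 1 pays for the mass, which deviates from affinity by
   [t * (1 - t) * (val a - val b) ^+ 2]. *)
exists (M + 1); first by rewrite addr_ge0.
move=> [a u] [b v] t t01; have /andP[t0 t1] := t01.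
have ha := itv_val_bounds a; have hb := itv_val_bounds b.
have /andP[a0 aL] := ha; have /andP[b0 bL] := hb.
have t1' : 0 <= 1 - t by rewrite subr_ge0.
have [e eE] : exists e : `[0, L]%classic, val e = (1 - t) * val a + t * val b.
  apply: itv_of_bounds; apply/andP; split.
    by rewrite addr_ge0// mulr_ge0// ltW.
  by have := ler_wpM2l t1' aL; have := ler_wpM2l (ltW t0) bL; lra.
have [h01 /(_ t t01)[w dw hw]] := hc u v.
have d2 : dO (a, u) (b, v) ^+ 2 = `|val a - val b| ^+ 2 + dB u v ^+ 2.
  by rewrite sqr_sqrtr// addr_ge0// sqr_ge0.
set D2 := _ ^+ 2 + _ in d2.
have F1 : dO (a, u) (e, w) = t * dO (a, u) (b, v).
  have dOE a1 u1 b1 v1 : dO (a1, u1) (b1, v1) =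
    Num.sqrt (`|val a1 - val b1| ^+ 2 + dB u1 v1 ^+ 2) by [].
  rewrite !dOE dw eE.
  have -> : val a - ((1 - t) * val a + t * val b) = t * (val a - val b) by ring.
  rewrite normrM gtr0_norm// !exprMn -mulrDr sqrtrM ?sqr_ge0//.
  by rewrite sqrtr_sqr (gtr0_norm t0).
have F2 : `|val e ^+ 2 *: K (val w) - val a ^+ 2 *: K (val u) -
    t *: (val b ^+ 2 *: K (val v) - val a ^+ 2 *: K (val u))| <= t * ((M + 1) * D2).
  have D20 : 0 <= D2 by rewrite addr_ge0// sqr_ge0.
  rewrite eE; apply: (ip_norm_le ip_inner) => [|z].
    exact: mulr_ge0 (ltW t0) (mulr_ge0 (addr_ge0 M0 ler01) D20).
  rewrite !(ipBl ip_inner) !(ipZl ip_inner) (ipBl ip_inner) !(ipZl ip_inner).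
  have cs y' k : `|y'| <= k -> `|ip y' z| <= k * `|z|.
    move=> yk; apply: le_trans (ip_cauchy_schwarz ip_inner _ _) _.
    by rewrite ler_wpM2r.
  apply: (@le_trans _ _ (t * (M * D2) * `|z|)).
    apply: (sqr_scaled_second_order ha hb t01) => //.
    - exact: ltW.
    - by rewrite -!(ipBl ip_inner) -(ipZl ip_inner) -(ipBl ip_inner); exact: cs.
    - exact: cs.
    - exact: cs.
    - by rewrite -(ipBl ip_inner); exact: cs.
  by rewrite ler_wpM2r// ler_pM2l// ler_wpM2r// lerDl.
have F3 : `|val e ^+ 2 - val a ^+ 2 - t * (val b ^+ 2 - val a ^+ 2)| <=
    t * ((M + 1) * D2).
  rewrite eE.
  have -> : ((1 - t) * val a + t * val b) ^+ 2 - val a ^+ 2 -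
      t * (val b ^+ 2 - val a ^+ 2) = - (t * ((1 - t) * (val a - val b) ^+ 2)).
    by ring.
  rewrite normrN normrM gtr0_norm// ler_pM2l// ger0_norm; last first.
    by rewrite mulr_ge0// sqr_ge0.
  rewrite /D2 real_normK ?num_real//.
  have h1 := sqr_ge0 (val a - val b); have h2 := sqr_ge0 (dB u v).
  have : 0 <= M * (val a - val b) ^+ 2 by rewrite mulr_ge0.
  have : 0 <= M * dB u v ^+ 2 by rewrite mulr_ge0.
  have : 0 <= t * (val a - val b) ^+ 2 by rewrite mulr_ge0// ltW.
  lra.
by exists (e, w); rewrite d2; split.
Qed.

Lemma Omega_mass_moves (x : Omega L B) e : 0 < e ->
  exists2 y, dO x y < e & massO y != massO x.
Proof.
move=> e0; case: x => a u; have /andP[a0 aL] := itv_val_bounds a.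
(* As [h] is at most half of [L], one of [val a + h] and [val a - h] stays in the interval. *)
pose h := Num.min e L / 2.
have m0 : 0 < Num.min e L by rewrite lt_min e0.
have h0 : 0 < h by rewrite divr_gt0.
have he : h < e.
  apply: (@lt_le_trans _ _ (Num.min e L)); last by rewrite ge_min lexx.
  by rewrite ltr_pdivrMr// ltr_pMr// ltr1n.
have hL : h + h <= L by rewrite -splitr ge_min lexx orbT.
have [b bL ba] : exists2 b, 0 <= b <= L & `|val a - b| = h.
  have [aL2|aL2] := leP (val a) h.
    exists (val a + h); first by apply/andP; split; lra.
    by rewrite opprD addrA subrr sub0r normrN gtr0_norm.
  exists (val a - h); first by apply/andP; split; lra.
  by rewrite opprB addrCA subrr addr0 gtr0_norm.
have [y yb] := itv_of_bounds bL; exists (y, u) => /=.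
  have [_ b1 _ _] := dBm.
  by rewrite /d_Omega/= yb ba (b1 u u).2// expr0n addr0 sqrtr_sqr gtr0_norm.
have /andP[b0 _] := bL.
rewrite yb eqrXn2//; apply/eqP => bE.
by move: h0; rewrite -ba bE subrr normr0 ltxx.
Qed.

End Omega.

(** * Identification of [J_n] and [d_n], and conclusion *)

Section EnergyOfAtoms.
Context {R : realType} {C : normedModType R} {Y : completeNormedModType R}.
Context (K : {linear dual C -> Y}) (F : Y -> R) (Reg : dual C -> \bar R).
Context (B : set (dual C)) (dB : B -> B -> R) (L : R).
Context (Reg_additive : no_loss_of_mass Reg B) (Reg_B : unit_mass Reg B).
Context (n : nat).

(** By (A6) and [Reg_B] the regulariser of the weighted sum is the sum of the weights [c ^+ 2 / n];
    in particular [J_n] is finite. *)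
Lemma J_nE (p : Omega_n L B n) : J_n K F Reg p =
  (energy_atoms F (fun w : Omega L B => val w.1 ^+ 2 *: K (val w.2))
    (fun w => val w.1 ^+ 2) (fun j => (p.1 j, p.2 j)))%:E.
Proof.
rewrite /J_n /energy /energy_atoms EFinD; congr (_%:E + _)%E.
  rewrite linearZ linear_sum; congr (F (_ *: _)).
  by apply: eq_bigr => j _; rewrite linearZ.
have uB (j : 'I_n) : B (val (p.2 j)) by exact: set_mem (valP _).
rewrite scaler_sumr; under eq_bigr do rewrite scalerA.
rewrite Reg_additive//; last by move=> j; rewrite mulr_ge0 ?invr_ge0 ?sqr_ge0.
under eq_bigr do rewrite Reg_B// mule1.
by rewrite sumEFin /average mulr_sumr.
Qed.

Lemma d_nE (p q : Omega_n L B n) : d_n dB p q =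
  dist_atoms (@d_Omega R C L B dB) (fun j => (p.1 j, p.2 j))
    (fun j => (q.1 j, q.2 j)).
Proof.
rewrite /d_n /dist_atoms /average; congr (Num.sqrt (_ * _)).
by apply: eq_bigr => j _; rewrite sqr_sqrtr// addr_ge0// sqr_ge0.
Qed.

End EnergyOfAtoms.

Unset Implicit Arguments.

Theorem theorem5p2 (R : realType)
  (C : completeNormedModType R) (C_separable : separable C)
  (Y : completeNormedModType R) (ip : Y -> Y -> R)
  (Y_hilbert : is_inner_product ip)
  (K : {linear dual C -> Y}) (F : Y -> R) (Reg : dual C -> \bar R)
  (Reg_ge0 : forall u, (0 <= Reg u)%E)
  (B : set (dual C)) (B_closed : closed B) (B_sub : B `<=` ext_closure Reg)
  (dB : B -> B -> R) (dB_metrizes : metrizes dB)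
  (dB_geodesic : geodesically_complete dB)
  (A1 : continuous (K : dual C -> weak_space Y))
  (A2 : [/\ bounded_below F, convex_real F & twice_frechet_differentiable F])
  (A3 : [/\ convex_ereal Reg, lower_semicontinuous Reg &
            positively_homogeneous Reg])
  (A4 : forall a : R, 0 <= a -> compact (sublevel Reg a))
  (A5 : seq_continuous_on (effective_domain Reg) K)
  (A6 : no_loss_of_mass Reg B)
  (A7 : ~ B 0)
  (A8 : geodesic_derivative_bound K dB ip)
  (Reg_B : unit_mass Reg B)
  (L : R) (L_gt0 : 0 < L) (n : nat) (n_ge1 : (1 <= n)%N)
  (w0 : Omega L B) (p : Omega_n L B n) :
  slope_lifted K F (empirical_measure dB w0 n_ge1 p) =
  slope_n K F Reg dB p.
Proof.
have [_ F_convex [F_diff _]] := A2.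
(* [Reg_B] places [B] in the sublevel set at height 1, compact by (A4). *)
have B_compact : compact B.
  apply: (subclosed_compact B_closed (A4 1 ler01)) => u /Reg_B.
  by rewrite /sublevel/= => ->.
have dm := d_Omega_metric dB_metrizes L.
have tb := totally_bounded_d_Omega B_compact dB_metrizes L.
have [D hD] := totally_bounded_bounded dm tb.
have [La hLa] := Omega_lipschitz Y_hilbert B_compact dB_metrizes dB_geodesic A8
  L_gt0 w0.2.
have [M M0 hM] := Omega_almost_geodesic Y_hilbert B_compact dB_metrizes
  dB_geodesic A8 L_gt0 w0.2.
have mv := Omega_mass_moves dB_metrizes L_gt0.
have := local_slope_empirical w0 dm tb hD Y_hilbert F_convex F_diff
  (fun x y => (hLa x y).1) (fun x y => (hLa x y).2) M0 hM mv n_ge1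
  (fun j => (p.1 j, p.2 j)).
pose at_ (q : Omega_n L B n) j : Omega L B := (q.1 j, q.2 j).
have slopeE : slope_n K F Reg dB p = local_slope (@dist_atoms R _ (@d_Omega R C L B dB) n)
    (fun q => (energy_atoms F (fun w : Omega L B => val w.1 ^+ 2 *: K (val w.2))
      (fun w => val w.1 ^+ 2) q)%:E) (at_ p).
  apply: local_slope_transfer.
  - exact: d_nE.
  - exact: J_nE.
  - move=> q; exists (fun j => (q j).1, fun j => (q j).2).
    by apply/funext => j; rewrite /at_/=; case: (q j).
rewrite slopeE => <-; rewrite /slope_lifted; congr (local_slope _ _ _).
apply/funext => nu; rewrite /lifted_energy /energy_lift EFinD; congr (_ + _)%E.
(* The mass term is bounded by [L ^+ 2], so its extended integral is finite and agrees with the real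
   one. *)
rewrite fineK//; apply: integrable_fin_num => //.
apply: (bounded_integrable nu (M := L ^+ 2)).
  by apply: measurable_lipschitz => //; exists La => x y; have [] := hLa x y.
move=> x; have /andP[x0 xL] := itv_val_bounds x.1.
by rewrite ger0_norm ?sqr_ge0// ler_pXn2r ?nnegrE// ltW.
Qed.
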